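(* Let $p$ be a prime. Let $\mathfrak{o}$ be a compact discrete valuation ring of characteristic zero with maximal ideal $\mathfrak{p}$ and residue field $\mathbf{k}=\mathfrak{o}/\mathfrak{p}$ of characteristic $p$, and let $\mathfrak{g}$ be a finite, nilpotent $\mathfrak{o}$-Lie algebra of nilpotency class $c<p$, with centre $\mathfrak{z}$ and derived algebra $\mathfrak{g}'$. Assume that $\mathfrak{g}'$ and $\mathfrak{g}/\mathfrak{z}$ are annihilated by $\mathfrak{p}$, with $\mathfrak{g}'\cong\mathbf{k}^b$ and $\mathfrak{g}/\mathfrak{z}\cong\mathbf{k}^a$ as $\mathbf{k}$-vector spaces. Let $\mathfrak{O}$ be a finite, unramified extension of $\mathfrak{o}$, with residue field isomorphic to $\mathbb{F}_q$. Let $G:=G(\mathfrak{O})$ be the finite $p$-group associated with $\mathfrak{g}(\mathfrak{O})=\mathfrak{g}\otimes_{\mathfrak{o}}\mathfrak{O}$ under the Lazard correspondence, and let $g\in G'$. Then, for each integer $i\ge 0$ and every complex number $s$, $$ \zeta^i_G(s,g)=|G/G'|\,q^{-i(1+s)}\left(K^i_G(g)-\frac{1}{q-1}V^i_G(g)\right), $$ where $\zeta^i_G(s,g)=\sum_{\chi}\chi(g)\chi(1)^{-s}$, the sum being over the irreducible complex characters $\chi$ of $G$ of degree $q^i$, and $K^i_G(g)$, $V^i_G(g)$ are the point counts defined in the context.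
   Context: Lazard correspondence: for a finite nilpotent Lie ring $L$ of $p$-power order and nilpotency class less than $p$, the associated group $\exp(L)$ is the set $L$ with multiplication given by the Baker-Campbell-Hausdorff formula; this gives an order-preserving bijection between finite nilpotent Lie rings of $p$-power order and class $<p$ and finite $p$-groups of class $<p$. The inverse is denoted $\log$. Here $G=G(\mathfrak{O})=\exp(\mathfrak{g}(\mathfrak{O}))$, the derived group $G'$ corresponds to $\mathfrak{g}(\mathfrak{O})'=\mathfrak{g}'\otimes_{\mathfrak{o}}\mathfrak{O}$, and an element $g\in G'$ is identified with $\log g\in\mathfrak{g}(\mathfrak{O})'$. Commutator matrix: fix $\mathbf{k}$-bases $\mathbf{e}=\{e_1,\dots,e_a\}$ of $\mathfrak{g}/\mathfrak{z}$ and $\mathbf{f}=\{f_1,\dots,f_b\}$ of $\mathfrak{g}'$, and let $\lambda_{ij}^k\in\mathbf{k}$ be the structure constants with $[e_i,e_j]=\sum_{k=1}^b\lambda_{ij}^k f_k$ and $\lambda_{ij}^k=-\lambda_{ji}^k$. For independent variables $\mathbf{Y}=(Y_1,\dots,Y_b)$ let $B(\mathbf{Y})\in\mathrm{Mat}_a(\mathbf{k}[\mathbf{Y}])$ be the skew-symmetric matrix with entries $B(\mathbf{Y})_{ij}=\sum_{k=1}^b\lambda_{ij}^kY_k$. For $\mathbf{y}\in\mathbb{F}_q^b$, where $\mathbb{F}_q$ is the residue field of $\mathfrak{O}$, viewed as an extension of $\mathbf{k}$, let $B(\mathbf{y})\in\mathrm{Mat}_a(\mathbb{F}_q)$ be the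 matrix obtained by evaluating $Y_k$ at $y_k$. The base extensions $f_k\otimes 1$, again denoted $f_k$, form an $\mathbb{F}_q$-basis of $\mathfrak{g}(\mathfrak{O})'$. For $g\in G'$ write $\log g=\sum_{k=1}^b g_kf_k$ with $g_k\in\mathbb{F}_q$, and for $\mathbf{y}\in\mathbb{F}_q^b$ put $\mathbf{y}\cdot g:=\sum_{k=1}^b y_kg_k\in\mathbb{F}_q$. Define $$K^i_G(g)=\#\{\mathbf{y}\in\mathbb{F}_q^b:\ \mathrm{rk}(B(\mathbf{y}))=2i,\ \mathbf{y}\cdot g=0\},$$ $$V^i_G(g)=\#\{\mathbf{y}\in\mathbb{F}_q^b:\ \mathrm{rk}(B(\mathbf{y}))=2i,\ \mathbf{y}\cdot g\neq0\}.$$ *)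

(* Defs.v *)
From HB Require Import structures.
From mathcomp Require Import all_boot all_order all_algebra.
From mathcomp Require Import all_fingroup all_solvable all_field all_character.
From mathcomp Require Import all_classical all_reals all_analysis.
From mathcomp.real_closed Require Import complex.
(* The notations of mpoly clash with those of mathcomp-analysis. *)
From mathcomp Require Import (canonicals) mpoly.

Set Implicit Arguments.
Unset Strict Implicit.
Unset Printing Implicit Defensive.

Import Order.TTheory GRing.Theory Num.Theory.
Local Open Scope classical_set_scope.
Local Open Scope ring_scope.

Definition is_ideal (R : comNzRingType) (I : set R) : Prop :=
  [/\ I 0, forall x y, I x -> I y -> I (x + y)
    & forall a x, I x -> I (a * x)].

Definition nonunits (R : comUnitRingType) : set R :=
  [set x | x \isn't a GRing.unit].

(* A discrete valuation ring: a local principal ideal domain that is not a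
   field.  Its maximal ideal is then [nonunits R]. *)
Definition is_dvr (R : idomainType) : Prop :=
  [/\ forall I : set R, is_ideal I -> exists a, I = [set a * x | x in setT],
      is_ideal (@nonunits R)
    & exists2 x : R, x != 0 & nonunits x].

Definition nonunits_pow (R : comUnitRingType) (n : nat) : set R :=
  smallest (@is_ideal R)
    [set \prod_(i < n) a i | a in [set a : 'I_n -> R | forall i, nonunits (a i)]].

(* [adic R] is a copy of [R] that carries the topology in which the powers of
   the maximal ideal are a base of neighbourhoods of 0. *)
Definition adic (R : comUnitRingType) : Type := R.

Section AdicTopology.
Variable R : comUnitRingType.

HB.instance Definition _ := Choice.on (adic R).

Definition adic_open (U : set (adic R)) : Prop :=
  forall x : R, U x -> exists n, forall y : R, nonunits_pow n (y - x) -> U y.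

Lemma nonunits_powD (m n : nat) (x : R) :
  nonunits_pow (m + n) x -> nonunits_pow m x.
Proof.
move=> h I [[I0 ID IM] sI]; apply: h; split=> // _ [a ha <-].
rewrite big_split_ord /= mulrC; apply: IM; apply: sI.
by exists (fun i => a (lshift n i)) => // i; exact: ha.
Qed.

Lemma adic_openT : adic_open setT.
Proof. by move=> x _; exists 0%N. Qed.

Lemma adic_openI (U V : set (adic R)) :
  adic_open U -> adic_open V -> adic_open (U `&` V).
Proof.
move=> oU oV x [/oU[m hm] /oV[n hn]]; exists (m + n)%N => y hy; split.
  by apply: hm; exact: nonunits_powD hy.
by apply: hn; rewrite addnC in hy; exact: nonunits_powD hy.
Qed.

Lemma adic_open_bigU (I : Type) (U : I -> set (adic R)) :
  (forall i, adic_open (U i)) -> adic_open (\bigcup_i U i).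
Proof.
move=> oU x [i _ /(oU i)[n hn]]; exists n => y /hn Uy.
by exists i.
Qed.

HB.instance Definition _ := isOpenTopological.Build (adic R)
  adic_openT adic_openI adic_open_bigU.

End AdicTopology.

Definition is_compact_dvr (R : idomainType) : Prop :=
  is_dvr R /\ compact [set: adic R].

Definition is_residue_map (R : comUnitRingType) (k : fieldType)
    (rho : {rmorphism R -> k}) : Prop :=
  (forall c, exists r, rho r = c) /\ (forall r, rho r = 0 <-> nonunits r).

(* Separability of the residue field extension is not required: it is automatic
   when the residue fields are finite. *)
Definition is_finite_unramified (R S : comUnitRingType)
    (phi : {rmorphism R -> S}) : Prop :=
  [/\ injective phi,
      exists (n : nat) (w : 'I_n -> S), forall x, exists c : 'I_n -> R,
        x = \sum_i phi (c i) * w i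
    & smallest (@is_ideal S) (phi @` @nonunits R) = @nonunits S].

HB.mixin Record Lmodule_isLieAlgebra (R : comNzRingType) V
    of GRing.Lmodule R V := {
  lie : V -> V -> V;
  lie_linearl : forall y a x1 x2,
    lie (a *: x1 + x2) y = a *: lie x1 y + lie x2 y;
  lie_linearr : forall x a y1 y2,
    lie x (a *: y1 + y2) = a *: lie x y1 + lie x y2;
  liexx : forall x, lie x x = 0;
  lie_jacobi : forall x y z,
    lie x (lie y z) + lie y (lie z x) + lie z (lie x y) = 0
}.

#[short(type="lieAlgType")]
HB.structure Definition LieAlgebra (R : comNzRingType) :=
  { V of GRing.Lmodule R V & Lmodule_isLieAlgebra R V }.

Definition is_submodule (R : comNzRingType) (V : lmodType R) (A : set V) : Prop :=
  [/\ A 0, forall x y, A x -> A y -> A (x + y)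
    & forall (a : R) x, A x -> A (a *: x)].

Section LieAlgebraNotions.
Variables (R : comNzRingType) (L : lieAlgType R).

Definition lie_set (A B : set L) : set L :=
  smallest (@is_submodule R L) [set lie x y | x in A & y in B].

Definition lie_derived : set L := lie_set setT setT.

Definition lie_center : set L := [set x | forall y, lie x y = 0].

(* Indexed from 0: [lie_lcs 0] is the whole algebra. *)
Fixpoint lie_lcs (n : nat) : set L :=
  if n is m.+1 then lie_set (lie_lcs m) setT else setT.

Definition has_nilpotency_class (c : nat) : Prop :=
  lie_lcs c = [set 0] /\ forall d, (d < c)%N -> lie_lcs d <> [set 0].

(* [x_1, [x_2, ... [x_(m-1), x_m]]] *)
Fixpoint lie_word (w : seq L) : L :=
  match w with
  | [::] => 0
  | [:: x] => x
  | x :: w' => lie x (lie_word w')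
  end.

End LieAlgebraNotions.

Arguments lie_derived {R} L.
Arguments lie_center {R} L.
Arguments lie_lcs {R} L n.
Arguments has_nilpotency_class {R} L c.

(* Dynkin's form of the Baker-Campbell-Hausdorff series, cut off in degrees
   >= p:
     sum_(n >= 1) (-1)^(n-1)/n sum_(r_i + s_i > 0)
       [x^(r_1) y^(s_1) ... x^(r_n) y^(s_n)]
       / ((sum_i (r_i + s_i)) prod_i r_i! s_i!).
   Terms of degree >= p vanish in nilpotency class < p, and the denominators of
   the remaining ones are prime to p, hence invertible in the scalars of
   interest. *)
Definition dynkin_degree (t : seq (nat * nat)) : nat :=
  (\sum_(u <- t) (u.1 + u.2))%N.

Definition dynkin_coef (t : seq (nat * nat)) : rat :=
  (-1) ^+ (size t).-1 /
    ((size t * dynkin_degree t * \prod_(u <- t) (u.1`! * u.2`!))%N)%:R.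

Definition bch (p : nat) (R : comUnitRingType) (L : lieAlgType R) (x y : L) : L :=
  let rs (n : nat) (u : n.-tuple ('I_p * 'I_p)) : seq (nat * nat) :=
    [seq (val v.1, val v.2) | v : 'I_p * 'I_p <- u] in
  let admissible (t : seq (nat * nat)) : bool :=
    all (fun v => 0 < v.1 + v.2)%N t && (dynkin_degree t < p)%N in
  \sum_(1 <= n < p) \sum_(u : n.-tuple ('I_p * 'I_p) | admissible (rs n u))
    ratr (dynkin_coef (rs n u)) *:
      lie_word (flatten [seq nseq v.1 x ++ nseq v.2 y | v <- rs n u]).

(* The finite group [gT] is exp L, with [log] the identification of its
   underlying set with [L]. *)
Definition is_exp (p : nat) (R : comUnitRingType) (L : lieAlgType R)
    (gT : finGroupType) (log : gT -> L) : Prop :=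
  bijective log /\ forall x y, log (x * y)%g = bch p (log x) (log y).

Definition is_tensor_product (R S : comNzRingType) (phi : {rmorphism R -> S})
    (M : lmodType R) (T : zmodType) (t : M -> S -> T) : Prop :=
  let balanced (U : zmodType) (f : M -> S -> U) :=
    [/\ forall x y a, f (x + y) a = f x a + f y a,
        forall x a b, f x (a + b) = f x a + f x b
      & forall r x a, f (r *: x) a = f x (phi r * a)] in
  balanced T t /\
  forall (U : zmodType) (f : M -> S -> U), balanced U f ->
    exists2 h : {additive T -> U}, (forall x a, h (t x a) = f x a)
      & forall h' : {additive T -> U}, (forall x a, h' (t x a) = f x a) ->
          h' =1 h.

(* [LS], with [t x a] in the role of x (x) a, is the S-Lie algebra obtained
   from [L] by extension of scalars along [phi]. *)
Definition is_scalar_extension (R S : comNzRingType) (phi : {rmorphism R -> S})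
    (L : lieAlgType R) (LS : lieAlgType S) (t : L -> S -> LS) : Prop :=
  [/\ is_tensor_product phi t,
      forall c x a, c *: t x a = t x (c * a)
    & forall x y a b, lie (t x a) (t y b) = t (lie x y) (a * b)].

Section ResidueVectorSpaces.
Variables (R : comUnitRingType) (k : fieldType) (rho : {rmorphism R -> k}).
Variable M : lmodType R.

(* The action of the residue field on vectors killed by the maximal ideal; on
   those it does not depend on the chosen lift of [c]. *)
Definition res_scale (c : k) (v : M) : M :=
  xget 0 [set r | rho r = c] *: v.

Definition res_lincomb (n : nat) (v : 'I_n -> M) (c : 'rV[k]_n) : M :=
  \sum_i res_scale (c 0 i) (v i).

(* [v] represents a basis of V / W over the residue field, where V / W is
   assumed to be killed by the maximal ideal. *)
Definition is_res_basis (V W : set M) (n : nat) (v : 'I_n -> M) : Prop :=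
  (forall i, V (v i)) /\
  forall x, V x -> exists! c : 'rV[k]_n, W (x - res_lincomb v c).

Definition res_coords (n : nat) (v : 'I_n -> M) (x : M) : 'rV[k]_n :=
  xget 0 [set c | x = res_lincomb v c].

End ResidueVectorSpaces.

Section CommutatorMatrix.
Variables (R : comUnitRingType) (k : fieldType) (rho : {rmorphism R -> k}).
Variables (L : lieAlgType R) (a b : nat) (e : 'I_a -> L) (f : 'I_b -> L).

Definition struct_const (i j : 'I_a) (l : 'I_b) : k :=
  res_coords rho f (lie (e i) (e j)) 0 l.

Definition comm_matrix : 'M[mpoly.mpoly b k]_a :=
  \matrix_(i, j) \sum_(l < b)
    struct_const i j l *: mpoly.mpolyX k (mpoly.mnm1 l).

End CommutatorMatrix.

Section PointCounts.
Variables (k : fieldType) (F : finFieldType) (iota : {rmorphism k -> F}).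
Variables (a b : nat) (B : 'M[mpoly.mpoly b k]_a).

Definition comm_matrix_at (y : 'rV[F]_b) : 'M[F]_a :=
  map_mx (mpoly.mmap iota (fun l => y 0 l)) B.

Definition row_dot (y z : 'rV[F]_b) : F := \sum_l y 0 l * z 0 l.

(* [gc] is the coordinate vector of log g *)
Definition K_count (i : nat) (gc : 'rV[F]_b) : nat :=
  #|[pred y : 'rV[F]_b |
      (\rank (comm_matrix_at y) == 2 * i)%N && (row_dot y gc == 0)]|.

Definition V_count (i : nat) (gc : 'rV[F]_b) : nat :=
  #|[pred y : 'rV[F]_b |
      (\rank (comm_matrix_at y) == 2 * i)%N && (row_dot y gc != 0)]|.

End PointCounts.

(* x ^ s = exp (s ln x), for x > 0 *)
Definition cpow (R : realType) (x : R) (s : R[i]) : R[i] :=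
  let r := expR (complex.Re s * ln x) in
  let theta := complex.Im s * ln x in
  Complex (r * cos theta) (r * sin theta).

(* [algC] is an abstract algebraic closure of the rationals, so that the values
   of characters are taken into R[i] along an embedding [sigma]. *)
Definition zeta_deg (R : realType) (sigma : {rmorphism algC -> R[i]})
    (gT : finGroupType) (n : nat) (s : R[i]) (x : gT) : R[i] :=
  \sum_(j : Iirr [set: gT]%G | 'chi_j 1%g == n%:R)
    sigma ('chi_j x) * cpow (Num.truncn ('chi_j 1%g))%:R (- s).

(* Main.v *)
Require Import Defs.
From HB Require Import structures.
From mathcomp Require Import all_boot all_order all_algebra.
From mathcomp Require Import all_fingroup all_solvable all_field all_character.
From mathcomp Require Import all_classical all_reals all_analysis.
From mathcomp.real_closed Require Import complex.
From mathcomp Require Import zify ring.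
From mathcomp Require Import (canonicals) mpoly.

(** The theorem is an instance of Kirillov's orbit method. Let [V] be the finite
Lie ring g(O), and let [rad psi] be the radical of the form [psi ([u, v])] that an
additive character [psi] of [V] defines.

Each [psi] yields an irreducible character of [G], induced from the linear
character [psi \o log] of [exp h], where [h] is a Lie subring that is its own
orthogonal for the form; its degree [n] satisfies [n ^ 2 = |V : rad psi|], and its
Fourier coefficient at [psi] is [1 / n] ([orbit_character], with [h] built in
[polarization_ideal]). By Parseval, an irreducible character of degree [n] arises
in this way from at most [n ^ 2] additive characters. As the number [|V|] of
additive characters is the sum [|G|] of the squares of the degrees, it arises from
exactly [n ^ 2], and it is [1 / n] times their sum ([fourier_fibre]). Therefore the
sum of [chi x] over the irreducible [chi] of degree [n] is [1 / n] times the sum of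
[psi (log x)] over the [psi] with [|V : rad psi| = n ^ 2] ([sum_irr_degree]).

The form depends on the restriction of [psi] to the derived algebra only. In the
coordinates given by the basis [f], such a restriction is [v |-> tau (y . v)], for
a fixed nontrivial character [tau] of F_q and a unique vector [y], and it extends
to [V] in [|V : g(O)'| = |G : G'|] ways ([sum_dual_derived], [card_derived_index]).
The form is then [tau] applied to the bilinear form of matrix [B(y)], whence
[|V : rad psi| = q ^ rk B(y)] ([card_radical_theta]). Since the rank of [B(y)] does
not change when [y] is multiplied by a nonzero scalar, [tau (y . log x)] may be
replaced by its average over the multiples of [y], which is 1 if [y . log x] is zero
and [- 1 / (q - 1)] otherwise ([sum_tau_cone]).

The orbit method needs three facts on the group law: Lie subrings are closed under
it, conjugation is additive through [log], and an element [z] that fixes [psi] has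
[log z] in [rad psi]. The first is immediate from the shape of the
Baker-Campbell-Hausdorff formula. The two others are read off from its terms of
degree at most two, because conjugation commutes with powers and
[log (x ^+ t) = log x *+ t]: in nilpotency class less than [p] all expressions are
polynomials in [t] of degree less than [p], and such a polynomial is determined by
its values ([coef_lsub], [log_conjD], [conj_lie]).

Finally, the coordinates on g(O)' exist because O is a free module over the
smaller ring, so that the independence of [f] survives in the tensor product
([derived_basis_free]). *)

Import Order.TTheory GRing.Theory Num.Theory.
Local Open Scope ring_scope.

Set Implicit Arguments.
Unset Strict Implicit.
Unset Printing Implicit Defensive.

(** * Lie algebras and Lie algebras of functions *)

Section LieTheory.
Local Open Scope classical_set_scope.

Section LieBasics.
Variables (R : comNzRingType) (L : lieAlgType R).
Implicit Types x y z : L.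

Lemma lieDl x y z : lie (x + y) z = lie x z + lie y z.
Proof. by have := lie_linearl z 1 x y; rewrite !scale1r. Qed.

Lemma lieDr x y z : lie z (x + y) = lie z x + lie z y.
Proof. by have := lie_linearr z 1 x y; rewrite !scale1r. Qed.

Lemma lie0l z : lie 0 z = 0.
Proof. by apply: (addIr (lie 0 z)); rewrite -lieDl !add0r. Qed.

Lemma lie0r z : lie z 0 = 0.
Proof. by apply: (addIr (lie z 0)); rewrite -lieDr !add0r. Qed.

Lemma lieZl (r : R) x z : lie (r *: x) z = r *: lie x z.
Proof. by have := lie_linearl z r x 0; rewrite lie0l !addr0. Qed.

Lemma lieZr (r : R) x z : lie z (r *: x) = r *: lie z x.
Proof. by have := lie_linearr z r x 0; rewrite lie0r !addr0. Qed.

Lemma lieNl x z : lie (- x) z = - lie x z.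
Proof. by rewrite -scaleN1r lieZl scaleN1r. Qed.

Lemma lieNr x z : lie z (- x) = - lie z x.
Proof. by rewrite -scaleN1r lieZr scaleN1r. Qed.

Lemma lieBl x y z : lie (x - y) z = lie x z - lie y z.
Proof. by rewrite lieDl lieNl. Qed.

Lemma lieBr x y z : lie z (x - y) = lie z x - lie z y.
Proof. by rewrite lieDr lieNr. Qed.

Lemma lieC x y : lie x y = - lie y x.
Proof.
apply/eqP; rewrite -addr_eq0; apply/eqP.
by have := liexx (x + y); rewrite !(lieDl, lieDr) !liexx add0r addr0 addrC.
Qed.

(** The Jacobi identity as a Leibniz rule for the adjoint action. *)
Lemma lie_jacobiE x y z : lie (lie x y) z = lie x (lie y z) - lie y (lie x z).
Proof.
have := lie_jacobi x y z; rewrite (lieC z (lie x y)) (lieC z x) lieNr.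
by move/eqP; rewrite subr_eq0 => /eqP <-.
Qed.

End LieBasics.

(** Families of elements of a Lie algebra are handled as elements of a Lie algebra
of functions, so that the general statements on the Baker-Campbell-Hausdorff
product apply to them. *)
Section FunctionLieAlgebra.
Variables (R : comNzRingType) (T : Type) (L : lieAlgType R).

Definition fct_lie (P Q : T -> L) : T -> L := fun u => lie (P u) (Q u).

Fact fct_lie_linearl (Q : T -> L) (a : R) P1 P2 :
  fct_lie (a *: P1 + P2) Q = a *: fct_lie P1 Q + fct_lie P2 Q.
Proof. by apply/funext => u; rewrite /fct_lie /= lie_linearl. Qed.

Fact fct_lie_linearr (P : T -> L) (a : R) Q1 Q2 :
  fct_lie P (a *: Q1 + Q2) = a *: fct_lie P Q1 + fct_lie P Q2.
Proof. by apply/funext => u; rewrite /fct_lie /= lie_linearr. Qed.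

Fact fct_liexx (P : T -> L) : fct_lie P P = 0.
Proof. by apply/funext => u; rewrite /fct_lie liexx. Qed.

Fact fct_lie_jacobi (P Q S : T -> L) :
  fct_lie P (fct_lie Q S) + fct_lie Q (fct_lie S P) + fct_lie S (fct_lie P Q)
    = 0.
Proof. by apply/funext => u; apply: lie_jacobi. Qed.

HB.instance Definition _ := Lmodule_isLieAlgebra.Build R (T -> L)
  fct_lie_linearl fct_lie_linearr fct_liexx fct_lie_jacobi.

Lemma lie_fctE (P Q : T -> L) (u : T) : lie P Q u = lie (P u) (Q u).
Proof. by []. Qed.

Lemma lie_word_fctE (w : seq (T -> L)) (u : T) :
  lie_word w u = lie_word [seq P u | P <- w].
Proof. by elim: w => [|P [|Q w] IH] //; exact: (congr1 (lie (P u)) IH). Qed.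

End FunctionLieAlgebra.

Lemma bch_fctE (p : nat) (R : comUnitRingType) (T : Type) (L : lieAlgType R)
    (P Q : T -> L) (u : T) :
  bch p P Q u = bch p (P u) (Q u).
Proof.
rewrite /bch fct_sumE; apply: eq_bigr => n _.
rewrite fct_sumE; apply: eq_bigr => v _ /=.
rewrite scalrfctE /=; congr (_ *: _); rewrite lie_word_fctE map_flatten -map_comp.
by congr (lie_word (flatten _)); apply: eq_map => w /=; rewrite map_cat !map_nseq.
Qed.

(** What the coefficients of the Baker-Campbell-Hausdorff formula preserve. The
kernel of an additive character is of this kind, although it is not a
submodule. *)
Definition local_subgroup (R : comUnitRingType) (L : lmodType R) (J : set L) :=
  [/\ J 0, forall x y, J x -> J y -> J (x - y)
    & forall n x, (n%:R : R) \is a GRing.unit -> J x -> J ((n%:R : R)^-1 *: x)].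

Section LocalSubgroup.
Variables (R : comUnitRingType) (L : lmodType R) (J : set L).
Hypothesis hJ : local_subgroup J.

Lemma lsub0 : J 0. Proof. by case: hJ. Qed.
Lemma lsubB x y : J x -> J y -> J (x - y). Proof. by case: hJ => _ /(_ x y). Qed.
Lemma lsubN x : J x -> J (- x).
Proof. by rewrite -sub0r; apply: lsubB; exact: lsub0. Qed.
Lemma lsubD x y : J x -> J y -> J (x + y).
Proof. by move=> Jx Jy; rewrite -[y]opprK; apply: lsubB => //; apply: lsubN. Qed.
Lemma lsub_sum (I : Type) (r : seq I) (P : pred I) (F : I -> L) :
  (forall i, P i -> J (F i)) -> J (\sum_(i <- r | P i) F i).
Proof. by move=> h; apply: big_ind => //; [exact: lsub0 | exact: lsubD]. Qed.
Lemma lsubMn x n : J x -> J (x *+ n).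
Proof.
move=> Jx; elim: n => [|n IH]; first by rewrite mulr0n; exact: lsub0.
by rewrite mulrS; apply: lsubD.
Qed.
Lemma lsubV n x : (n%:R : R) \is a GRing.unit -> J x -> J ((n%:R : R)^-1 *: x).
Proof. by case: hJ => _ _; apply. Qed.
Lemma lsub_divn n x : (n%:R : R) \is a GRing.unit -> J (x *+ n) -> J x.
Proof. by move=> un /(lsubV un); rewrite -scaler_nat scalerA mulVr // scale1r. Qed.
End LocalSubgroup.

Lemma submodule_local (R : comUnitRingType) (L : lmodType R) (J : set L) :
  is_submodule J -> local_subgroup J.
Proof.
case=> J0 JD JZ; split=> // [x y Jx Jy|n x _]; last exact: JZ.
by apply: JD => //; rewrite -scaleN1r; apply: JZ.
Qed.

Lemma local_set0 (R : comUnitRingType) (L : lmodType R) :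
  local_subgroup [set 0 : L].
Proof.
split=> [//|x y /= -> ->|n x _ /= ->]; first by rewrite subr0.
by rewrite scaler0.
Qed.

Section SmallestSubmodule.
Variables (R : comUnitRingType) (L : lmodType R).

Lemma smallest_submodule (A : set L) :
  is_submodule (smallest (@is_submodule R L) A).
Proof.
split=> [B [[B0 _ _] _] //|x y hx hy B hB|r x hx B hB].
  by case: (hB) => -[_ BD _] _; apply: BD; [exact: hx | exact: hy].
by case: (hB) => -[_ _ BZ] _; apply: BZ; exact: hx.
Qed.

Lemma sub_smallest_submodule (A : set L) :
  A `<=` smallest (@is_submodule R L) A.
Proof. by move=> x Ax B [_]; apply. Qed.

Lemma smallest_submodule_sub (A B : set L) :
  is_submodule B -> A `<=` B -> smallest (@is_submodule R L) A `<=` B.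
Proof. by move=> hB AB x; apply. Qed.

End SmallestSubmodule.

Lemma lie_smallest_sub (R : comUnitRingType) (L : lieAlgType R) (A B C : set L) :
    is_submodule C -> (forall x y, A x -> B y -> C (lie x y)) ->
  forall x y, smallest (@is_submodule R L) A x ->
    smallest (@is_submodule R L) B y -> C (lie x y).
Proof.
move=> [C0 CD CZ] hAB x y hx hy.
suff: smallest (@is_submodule R L) A `<=`
    [set u | forall v, smallest (@is_submodule R L) B v -> C (lie u v)].
  by apply.
apply: smallest_submodule_sub.
  split=> [v _|u1 u2 h1 h2 v hv|r u hu v hv] /=.
  - by rewrite lie0l.
  - by rewrite lieDl; apply: CD; [exact: h1 | exact: h2].
  - by rewrite lieZl; apply: CZ; exact: hu.
move=> u Au; apply: smallest_submodule_sub.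
  split=> [|u1 u2 h1 h2|r v hv] /=.
  - by rewrite lie0r.
  - by rewrite lieDr; apply: CD.
  - by rewrite lieZr; apply: CZ.
by move=> v Bv; apply: hAB.
Qed.

End LieTheory.

(** * The Baker-Campbell-Hausdorff product modulo Lie words *)

Section BCH.
Local Open Scope classical_set_scope.

Lemma ratr_sign_divn (R : comUnitRingType) (k n : nat) : (0 < n)%N ->
  ratr ((-1) ^+ k / n%:R : rat) = (-1) ^+ k * (n%:R)^-1 :> R.
Proof.
move=> n0; have cop : coprime `|(-1) ^+ k : int| `|n%:Z|.
  by rewrite abszX abszN exp1n coprime1n.
have -> : ((-1) ^+ k / n%:R : rat) = ((-1) ^+ k : int)%:~R / (n%:Z)%:~R.
  by rewrite rmorphXn rmorphN1 pmulrn.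
rewrite /ratr (coprimeq_num cop) (coprimeq_den cop).
have -> : (n%:Z == 0) = false by case: n n0 {cop}.
by rewrite gtr0_sg ?ltz_nat // mul1r rmorphXn rmorphN1.
Qed.

Variables (p : nat) (R : comUnitRingType) (L : lieAlgType R).
Hypothesis unit_lt : forall n, (0 < n < p)%N -> (n%:R : R) \is a GRing.unit.

Definition dynkin_word (t : seq (nat * nat)) (x y : L) : L :=
  lie_word (flatten [seq nseq v.1 x ++ nseq v.2 y | v <- t]).

Lemma size_dynkin_word t (x y : L) :
  size (flatten [seq nseq v.1 x ++ nseq v.2 y | v <- t]) = dynkin_degree t.
Proof.
rewrite /dynkin_degree; elim: t => [|v t IH] /=; first by rewrite big_nil.
by rewrite big_cons size_cat IH size_cat !size_nseq.
Qed.

Lemma mem_dynkin_word t (x y : L) :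
  {subset flatten [seq nseq v.1 x ++ nseq v.2 y | v <- t] <= [:: x; y]}.
Proof.
move=> z /flattenP[w /mapP[v _ ->]]; rewrite mem_cat !mem_nseq !inE.
by case/orP=> /andP[_ ->] //; rewrite orbT.
Qed.

Lemma leq_size_dynkin_degree (t : seq (nat * nat)) :
  all (fun v => 0 < v.1 + v.2)%N t -> (size t <= dynkin_degree t)%N.
Proof.
rewrite /dynkin_degree; elim: t => //= v t IH /andP[v0 /IH].
by rewrite big_cons; exact: leq_add v0.
Qed.

Lemma unit_fact n : (n < p)%N -> (n`!%:R : R) \is a GRing.unit.
Proof.
elim: n => [|n IH] np; first by rewrite fact0 unitr1.
by rewrite factS natrM unitrM unit_lt //= IH // ltnW.
Qed.

(** All the factors are products of integers that are bounded by the degree. *)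
Lemma unit_dynkin_denom (t : seq (nat * nat)) :
    all (fun v => 0 < v.1 + v.2)%N t -> (dynkin_degree t < p)%N ->
    (0 < size t)%N ->
  ((size t * dynkin_degree t * \prod_(u <- t) (u.1`! * u.2`!))%N%:R : R)
    \is a GRing.unit.
Proof.
move=> at0 dp s0; have sd := leq_size_dynkin_degree at0.
rewrite !natrM !unitrM unit_lt ?s0 ?(leq_ltn_trans sd) //=.
rewrite unit_lt ?dp ?(leq_trans s0) //= {at0 s0 sd}.
elim: t dp => [|v t IH]; first by rewrite big_nil unitr1.
rewrite /dynkin_degree !big_cons => dp.
have lt m : (m <= v.1 + v.2 + \sum_(j <- t) (j.1 + j.2))%N -> (m < p)%N.
  by move=> ?; apply: leq_ltn_trans dp.
rewrite !natrM !unitrM !unit_fact ?IH ?lt //; first exact: leq_addl.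
  by rewrite addnAC leq_addl.
by rewrite -addnA leq_addr.
Qed.

Lemma ratr_dynkin_coef (t : seq (nat * nat)) : (0 < size t)%N ->
    all (fun v => 0 < v.1 + v.2)%N t ->
  ratr (dynkin_coef t) = (-1) ^+ (size t).-1 *
    ((size t * dynkin_degree t * \prod_(u <- t) (u.1`! * u.2`!))%N%:R)^-1 :> R.
Proof.
move=> s0 at0; rewrite /dynkin_coef ratr_sign_divn // !muln_gt0 s0.
rewrite (leq_trans s0 (leq_size_dynkin_degree at0)) /=.
by rewrite prodn_gt0 // => u; rewrite muln_gt0 !fact_gt0.
Qed.

Section Membership.
Variable J : set L.
Hypothesis hJ : local_subgroup J.

Lemma lsub_dynkin_coef (t : seq (nat * nat)) (x : L) :
    all (fun v => 0 < v.1 + v.2)%N t -> (dynkin_degree t < p)%N ->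
    (0 < size t)%N ->
  J x -> J (ratr (dynkin_coef t) *: x).
Proof.
move=> at0 dp s0 Jx; rewrite ratr_dynkin_coef // -scalerA.
have := lsubV hJ (unit_dynkin_denom at0 dp s0) Jx.
case: (odd (size t).-1) (signr_odd R (size t).-1) => <- Jy.
  by rewrite expr1 scaleN1r; apply: lsubN.
by rewrite expr0 scale1r.
Qed.

(** Two Lie words whose letters are congruent modulo [J] are congruent modulo [J],
by induction on the length; here [J] has to be stable under [A] only. *)
Lemma bch_congr (A : set L) (x x' y y' : L) :
    (forall u v, A u -> A v -> A (lie u v)) ->
    (forall u v, A u -> J v -> J (lie u v)) ->
    A x -> A x' -> A y -> A y' -> J (x - x') -> J (y - y') ->
  J (bch p x y - bch p x' y').
Proof.
move=> AA AJ Ax Ax' Ay Ay' Jx Jy; rewrite /bch big_nat [X in _ - X]big_nat.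
rewrite -sumrB; apply: (lsub_sum hJ) => n /andP[n0 _].
rewrite -sumrB; apply: (lsub_sum hJ) => u /andP[at0 dp]; rewrite -scalerBr.
apply: lsub_dynkin_coef => //; first by rewrite size_map size_tuple.
move: (map _ u) => t {at0 dp u}.
set w := flatten _; set w' := flatten _.
pose r (u v : L) := `[< A u /\ A v /\ J (u - v) >].
have r_cat s1 s1' s2 s2' :
    all2 r s1 s1' -> all2 r s2 s2' -> all2 r (s1 ++ s2) (s1' ++ s2').
  by elim: s1 s1' => [|u1 s1 IH] [|u1' s1'] //= /andP[-> /IH]; apply.
have zP : all2 r w w'.
  rewrite {}/w {}/w'; elim: t => //= v t IH.
  apply: (r_cat _ _ _ _ _ IH); apply: (r_cat); [elim: v.1|elim: v.2] => //= ? ->;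
    by rewrite andbT; apply/asboolP.
have Aw (s s' : seq L) : all2 r s s' ->
    (0 < size s)%N ->
    [/\ A (lie_word s), A (lie_word s') & J (lie_word s - lie_word s')].
  elim: s s' => [|u s IH] [|u' s'] //= /andP[/asboolP[Au [Au' Juu']] hs] _.
  case: s IH hs => [|v s] IH; case: s' => [|v' s'] hs.
  - by [].
  - by [].
  - by [].
  - have [Asv Asv' Jsv] := IH (v' :: s') hs isT.
    split; [exact: AA | exact: AA |].
    change (J (lie u (lie_word (v :: s)) - lie u' (lie_word (v' :: s')))).
    have -> : lie u (lie_word (v :: s)) - lie u' (lie_word (v' :: s')) =
        lie u (lie_word (v :: s) - lie_word (v' :: s'))
          + lie (u - u') (lie_word (v' :: s')).
      by rewrite lieBr lieBl addrA subrK.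
    apply: (lsubD hJ); first exact: AJ.
    by rewrite lieC; apply: (lsubN hJ); exact: AJ.
case: (posnP (size w)) => [w0|/(Aw _ _ zP)[] //].
have w'0 : size w' = 0%N by rewrite size_dynkin_word -w0 size_dynkin_word.
by rewrite (size0nil w0) (size0nil w'0) subrr; exact: (lsub0 hJ).
Qed.

Definition words_in (m : nat) (x y : L) :=
  forall w, (m <= size w)%N -> {subset w <= [:: x; y]} -> J (lie_word w).

Lemma lsub_dynkin_term m t x y :
    all (fun v => 0 < v.1 + v.2)%N t -> (dynkin_degree t < p)%N ->
    (0 < size t)%N ->
    words_in m x y -> (m <= dynkin_degree t)%N ->
  J (ratr (dynkin_coef t) *: dynkin_word t x y).
Proof.
move=> at0 dp s0 h mt; apply: lsub_dynkin_coef => //; apply: h.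
  by rewrite size_dynkin_word.
exact: mem_dynkin_word.
Qed.

Lemma lsub_bch x y : words_in 1 x y -> J (bch p x y).
Proof.
move=> h; rewrite /bch big_nat; apply: (lsub_sum hJ) => n /andP[n0 _].
apply: (lsub_sum hJ) => u /andP[at0 dp].
have s0 : (0 < size [seq (val v.1, val v.2) | v : 'I_p * 'I_p <- u])%N.
  by rewrite size_map size_tuple.
apply: lsub_dynkin_term h _ => //.
exact: leq_trans (leq_size_dynkin_degree at0).
Qed.

(** A term indexed by an [n]-tuple has degree at least [n], so that for the terms of
degree less than [m] only the tuples shorter than [m] matter. *)
Lemma lsub_bch_tail m x y : (0 < m)%N -> words_in m x y ->
  J (bch p x y - \sum_(1 <= n < minn p m)
      \sum_(u : n.-tuple ('I_p * 'I_p) |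
          let t := [seq (val v.1, val v.2) | v : 'I_p * 'I_p <- u] in
          all (fun v => 0 < v.1 + v.2)%N t && (dynkin_degree t < p)%N)
        let t := [seq (val v.1, val v.2) | v : 'I_p * 'I_p <- u] in
        ratr (dynkin_coef t) *: dynkin_word t x y).
Proof.
move=> m0 h; rewrite /bch.
case: (leqP p m) => [pm|mp]; first by rewrite subrr; exact: (lsub0 hJ).
rewrite (big_cat_nat m0 (ltnW mp)) /= addrAC subrr add0r.
rewrite big_nat; apply: (lsub_sum hJ) => n /andP[mn _].
apply: (lsub_sum hJ) => u /andP[at0 dp].
have su : size [seq (val v.1, val v.2) | v : 'I_p * 'I_p <- u] = n.
  by rewrite size_map size_tuple.
apply: lsub_dynkin_term h _ => //; first by rewrite su (leq_trans m0).
by apply: leq_trans (leq_size_dynkin_degree at0); rewrite su.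
Qed.

End Membership.
End BCH.

Section TupleSums.
Variables (V : nmodType) (T : finType).

Lemma big_tuple1 (P : pred (1.-tuple T)) (F : 1.-tuple T -> V) :
  \sum_(u | P u) F u = \sum_(v | P [tuple v]) F [tuple v].
Proof.
apply: (reindex (fun v => [tuple v])); apply: onW_bij.
exists (fun u => thead u) => [v|u]; first by [].
by apply: val_inj; case/tupleP: u => v u /=; rewrite (tuple0 u).
Qed.

Lemma big_tuple2 (P : pred (2.-tuple T)) (F : 2.-tuple T -> V) :
  \sum_(u | P u) F u =
  \sum_(v : T * T | P [tuple v.1; v.2]) F [tuple v.1; v.2].
Proof.
apply: (reindex (fun v : T * T => [tuple v.1; v.2])); apply: onW_bij.
exists (fun u => (thead u, thead (behead_tuple u))) => [[v w]|u] //=.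
apply: val_inj => /=; case/tupleP: u => v u; case/tupleP: u => w u /=.
by rewrite (tuple0 u).
Qed.

End TupleSums.

Section BCHExpansion.
Local Open Scope classical_set_scope.
Variables (p : nat) (R : comUnitRingType) (L : lieAlgType R).
Hypothesis unit_lt : forall n, (0 < n < p)%N -> (n%:R : R) \is a GRing.unit.
Variable J : set L.
Hypothesis hJ : local_subgroup J.

Lemma lsub_bch_lin (x y : L) : (1 < p)%N -> words_in J 2 x y ->
  J (bch p x y - (x + y)).
Proof.
move=> p1 h; have := lsub_bch_tail unit_lt hJ (isT : 0 < 2)%N h.
rewrite (minn_idPr p1) big_nat1; move: (bch p x y) => z.
case: p p1 unit_lt => [|[|n]] // _ ult.
rewrite big_tuple1 /=.
pose i0 : 'I_n.+2 := Ordinal (isT : 0 < n.+2)%N.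
pose i1 : 'I_n.+2 := Ordinal (isT : 1 < n.+2)%N.
(* The pairs (1, 0) and (0, 1) index the words [x] and [y]. *)
rewrite (bigD1 (i1, i0)) /=; last by rewrite /dynkin_degree big_seq1.
rewrite (bigD1 (i0, i1)) /=; last by rewrite /dynkin_degree big_seq1.
rewrite !ratr_dynkin_coef // /dynkin_degree !big_seq1 /= !fact0 !muln1 invr1.
rewrite !mulr1 expr0 !scale1r /dynkin_word /=.
set S := (X in J (_ - (_ + (_ + X)))).
suff JS : J S.
  move=> /(lsubD hJ)/(_ JS); congr J.
  by rewrite (addrA x y S) (opprD (x + y) S) addrA subrK.
apply: (lsub_sum hJ) => -[[v vn] [w wn]] /=.
rewrite !xpair_eqE -!val_eqE /= andbT => /andP[/andP[adm ne1] ne2].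
apply: (lsub_dynkin_term ult hJ _ _ _ h) => /=; rewrite /dynkin_degree ?big_seq1 //=.
all: move: adm; rewrite /dynkin_degree ?big_seq1 /=; lia.
Qed.

(** In degree two, the tuple [(1, 1)] contributes half of the bracket, and the
contributions of [(1, 0), (0, 1)] and [(0, 1), (1, 0)] cancel. *)
Lemma lsub_bch_quad (x y : L) : (2 < p)%N -> words_in J 3 x y ->
  J (bch p x y - (x + y + (2%:R : R)^-1 *: lie x y)).
Proof.
move=> p2 h; have := lsub_bch_tail unit_lt hJ (isT : 0 < 3)%N h.
rewrite (minn_idPr p2) big_ltn // big_nat1; move: (bch p x y) => z.
case: p p2 unit_lt => [|[|[|n]]] // _ ult.
rewrite big_tuple1 big_tuple2 /=.
pose i0 : 'I_n.+3 := Ordinal (isT : 0 < n.+3)%N.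
pose i1 : 'I_n.+3 := Ordinal (isT : 1 < n.+3)%N.
rewrite (bigD1 (i1, i0)) /=; last by rewrite /dynkin_degree big_seq1.
rewrite (bigD1 (i0, i1)) /=; last by rewrite /dynkin_degree big_seq1.
rewrite (bigD1 (i1, i1)) /=; last by rewrite /dynkin_degree big_seq1.
set S1 := (X in J (_ - (_ + (_ + (_ + X)) + _))).
rewrite (bigD1 ((i1, i0), (i0, i1))) /=; last first.
  by rewrite /dynkin_degree !big_cons big_nil.
rewrite (bigD1 ((i0, i1), (i1, i0))) /=; last first.
  by rewrite /dynkin_degree !big_cons big_nil.
set S2 := (X in J (_ - (_ + (_ + (_ + X))))).
have JS1 : J S1.
  apply: (lsub_sum hJ) => -[[v vn] [w wn]] /=.
  rewrite !xpair_eqE -!val_eqE /= => /andP[/andP[/andP[adm ne1] ne2] ne3].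
  have [vw3|vw2] := leqP 3 (v + w).
    apply: (lsub_dynkin_term ult hJ _ _ _ h) => /=;
      by move: adm; rewrite /dynkin_degree ?big_seq1 //=; lia.
  have [[-> ->]|[-> ->]] : (v = 2 /\ w = 0) \/ (v = 0 /\ w = 2) by lia.
    by rewrite /dynkin_word /= liexx scaler0; exact: (lsub0 hJ).
  by rewrite /dynkin_word /= liexx scaler0; exact: (lsub0 hJ).
have JS2 : J S2.
  apply: (lsub_sum hJ) => -[[[a an] [b bn]] [[c cn] [d dn]]] /=.
  rewrite !xpair_eqE -!val_eqE /= => /andP[/andP[adm ne1] ne2].
  have [abcd3|abcd2] := leqP 3 (a + b + (c + d)).
    apply: (lsub_dynkin_term ult hJ _ _ _ h) => /=;
      by move: adm; rewrite /dynkin_degree ?big_cons ?big_nil //=; lia.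
  have [[-> -> -> ->]|[-> -> -> ->]] :
      [/\ a = 1, b = 0, c = 1 & d = 0] \/ [/\ a = 0, b = 1, c = 0 & d = 1].
  - have: a = 1 /\ b = 0 \/ a = 0 /\ b = 1 by lia.
    have: c = 1 /\ d = 0 \/ c = 0 /\ d = 1 by lia.
    by move=> [[c1 d1]|[c1 d1]] [[a1 b1]|[a1 b1]]; subst; [left|exfalso|exfalso|right];
      move: ne1 ne2.
  - by rewrite /dynkin_word /= liexx scaler0; exact: (lsub0 hJ).
  - by rewrite /dynkin_word /= liexx scaler0; exact: (lsub0 hJ).
move: S1 S2 JS1 JS2 => S1 S2 JS1 JS2.
rewrite !ratr_dynkin_coef // /dynkin_degree !big_cons !big_nil /=.
rewrite !fact0 !factS !fact0 !muln1 invr1 mulr1 expr0 !scale1r !mul1r !mul1n.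
rewrite /dynkin_word /= (lieC y x) expr1 scalerN.
move=> /(lsubD hJ)/(_ (lsubD hJ JS1 JS2)); congr J.
set c := _ *: lie x y; set d := _ *: lie x y.
have -> : x + (y + (c + S1)) + (d + (- d + S2)) = x + y + c + (S1 + S2).
  by rewrite (addrA d) subrr add0r !addrA.
by move: (S1 + S2) => S; rewrite opprD addrA subrK.
Qed.

End BCHExpansion.

(** * Polynomial maps with values in a nilpotent Lie algebra *)

Section LowerCentralSeries.
Local Open Scope classical_set_scope.
Variables (R : comUnitRingType) (L : lieAlgType R).

Lemma lieMnl (x y : L) n : lie (x *+ n) y = lie x y *+ n.
Proof. by rewrite -!scaler_nat lieZl. Qed.

Lemma lieMnr (x y : L) n : lie x (y *+ n) = lie x y *+ n.
Proof. by rewrite -!scaler_nat lieZr. Qed.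

Lemma submodule_lcs n : is_submodule (lie_lcs L n).
Proof. by case: n => [|n]; [split | exact: smallest_submodule]. Qed.

Lemma lcs_lie n (x y : L) : lie_lcs L n x -> lie_lcs L n.+1 (lie x y).
Proof. by move=> hx; apply: sub_smallest_submodule; exists x => //; exists y. Qed.

Lemma lcsS n : lie_lcs L n.+1 `<=` lie_lcs L n.
Proof.
elim: n => [//|n IH]; apply: smallest_submodule_sub.
  exact: smallest_submodule.
by move=> _ [x /IH hx [y _ <-]]; exact: lcs_lie.
Qed.

Lemma lcs_anti m n : (m <= n)%N -> lie_lcs L n `<=` lie_lcs L m.
Proof.
move=> /subnK <-; elim: (n - m)%N => [//|d IH].
by apply: subset_trans IH; exact: lcsS.
Qed.

Lemma lcs_lie_add m n (x y : L) :
  lie_lcs L m x -> lie_lcs L n y -> lie_lcs L (m + n).+1 (lie x y).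
Proof.
elim: n m x y => [|n IH] m x y hx hy; first by rewrite addn0; exact: lcs_lie.
have [_ CD CZ] := submodule_lcs (m + n.+1).+1.
suff: lie_lcs L n.+1 `<=` [set v | lie_lcs L (m + n.+1).+1 (lie x v)] by apply.
apply: smallest_submodule_sub.
  split=> [|u v|r u] /=.
  - by rewrite lie0r; case: (submodule_lcs (m + n.+1).+1).
  - by rewrite lieDr; exact: CD.
  - by rewrite lieZr; exact: CZ.
move=> _ [u hu [v _ <-]] /=.
have -> : lie x (lie u v) = lie (lie x u) v - lie (lie x v) u.
  by rewrite [lie (lie x v) u]lieC opprK lie_jacobiE subrK.
apply: (lsubB (J := lie_lcs L (m + n.+1).+1)).
  exact/submodule_local/submodule_lcs.
  by rewrite addnS; apply: lcs_lie; exact: IH.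
by rewrite addnS -addSn; apply: IH => //; exact: lcs_lie.
Qed.

(** The lower central series indexed from 1, extended by its first term in
index 0, so that it becomes a grading filtration for which constants may be
given weight 0. *)
Definition lie_filtration (d : nat) : set L := lie_lcs L d.-1.

Lemma filtration_lie d e (x y : L) :
  lie_filtration d x -> lie_filtration e y -> lie_filtration (d + e) (lie x y).
Proof.
rewrite /lie_filtration; case: d => [|d] hx hy.
  by apply: (lcs_anti (n := (0 + e.-1).+1)) (lcs_lie_add hx hy); rewrite leqnSn.
apply: (lcs_anti (n := (d + e.-1).+1)) (lcs_lie_add hx hy).
by case: e {hy} => [|e] /=; rewrite ?addn0 ?leqnSn // addnS.
Qed.

Lemma filtration_anti d e : (d <= e)%N -> lie_filtration e `<=` lie_filtration d.
Proof. by move=> de; apply: lcs_anti; rewrite -!subn1 leq_sub2r. Qed.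

End LowerCentralSeries.

Section PolynomialMaps.
Local Open Scope classical_set_scope.
Variables (p : nat) (R : comUnitRingType) (L : lieAlgType R).
Hypothesis p_gt1 : (1 < p)%N.
Hypothesis unit_lt : forall n, (0 < n < p)%N -> (n%:R : R) \is a GRing.unit.
Hypothesis nilL : lie_filtration p `<=` [set 0 : L].

Definition monomial (d : nat) (v : L) : nat -> L := fun t => v *+ t ^ d.

(** Spanned by the [v *+ t ^ d] with [d >= m] and [v] of weight [d + k] in the lower
central series. A map in [poly_maps 0 m] is [O(t ^ m)], and the first index records
an excess of weight, which bounds the degree. *)
Definition poly_maps (k m : nat) : set (nat -> L) :=
  smallest (@is_submodule R (nat -> L))
    [set P | exists d v,
       [/\ (m <= d)%N, lie_filtration (d + k) v & P = monomial d v]].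

Lemma submodule_poly_maps k m : is_submodule (poly_maps k m).
Proof. exact: smallest_submodule. Qed.

Lemma poly_monomial k m d v :
  (m <= d)%N -> lie_filtration (d + k) v -> poly_maps k m (monomial d v).
Proof. by move=> md hv; apply: sub_smallest_submodule; exists d, v. Qed.

Lemma poly_maps_anti k m k' m' : (k' <= k)%N -> (m' <= m)%N ->
  poly_maps k m `<=` poly_maps k' m'.
Proof.
move=> kk mm; apply: smallest_submodule_sub; first exact: submodule_poly_maps.
move=> _ [d [v [md hv ->]]]; apply: poly_monomial; first exact: leq_trans md.
by apply: filtration_anti hv; rewrite leq_add2l.
Qed.

Lemma poly_lie k m k' m' P Q : poly_maps k m P -> poly_maps k' m' Q ->
  poly_maps (k + k') (m + m') (lie P Q).
Proof.
move: P Q; apply: lie_smallest_sub; first exact: submodule_poly_maps.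
move=> _ _ [d [v [md hv ->]]] [e [w [me hw ->]]].
have -> : lie (monomial d v) (monomial e w) = monomial (d + e) (lie v w).
  apply/funext => t; rewrite lie_fctE /monomial lieMnl lieMnr -mulrnA.
  by rewrite expnD mulnC.
apply: poly_monomial; first exact: leq_add.
by rewrite addnACA; exact: filtration_lie.
Qed.

Lemma poly_const x : poly_maps 1 0 (fun=> x).
Proof.
have -> : (fun=> x) = monomial 0 x by apply/funext => t; rewrite /monomial mulr1n.
exact: poly_monomial.
Qed.

Lemma poly_linear x : poly_maps 0 1 (fun t => x *+ t).
Proof.
have -> : (fun t => x *+ t) = monomial 1 x.
  by apply/funext => t; rewrite /monomial expn1.
exact: poly_monomial.
Qed.

(** Each letter brings a factor [t]. *)
Lemma words_in_poly n P Q : (0 < n)%N ->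
  poly_maps 0 1 P -> poly_maps 0 1 Q -> words_in (poly_maps 0 n) n P Q.
Proof.
move=> n0 hP hQ w nw sw; apply: (poly_maps_anti (leqnn 0) nw).
have {n0 nw} : (0 < size w)%N by exact: leq_trans nw.
elim: w sw => [//|S w IH] sw _.
have hS : poly_maps 0 1 S.
  by move: (sw S (mem_head _ _)); rewrite !inE => /orP[] /eqP->.
case: w IH sw => [//|T w] IH sw.
change (poly_maps (0 + 0) (1 + (size w).+1) (lie S (lie_word (T :: w)))).
apply: poly_lie => //; apply: IH => // U hU; apply: sw.
by rewrite inE hU orbT.
Qed.

(** Monomials of degree at least [p] vanish by nilpotency. *)
Lemma poly_maps_coef k m P : poly_maps k m P -> exists a : nat -> L,
  [/\ forall d, lie_filtration (d + k) (a d), forall d, (d < m)%N -> a d = 0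
    & forall t, P t = \sum_(d < p) a d *+ t ^ d].
Proof.
have lf0 d : lie_filtration d (0 : L) by case: (submodule_lcs L d.-1).
apply: (@smallest_submodule_sub _ (nat -> L) _ [set Q | exists a : nat -> L,
  [/\ forall d, lie_filtration (d + k) (a d), forall d, (d < m)%N -> a d = 0
    & forall t, Q t = \sum_(d < p) a d *+ t ^ d]]).
- split=> [|Q1 Q2 [a1 [f1 z1 e1]] [a2 [f2 z2 e2]]|r Q [a [f z e]]] /=.
  + exists (fun=> 0); split=> // t; rewrite big1 // => d _; by rewrite mul0rn.
  + exists (fun d => a1 d + a2 d); split=> [d|d dm|t].
    * by have [_ CD _] := submodule_lcs L (d + k).-1; exact: CD (f1 d) (f2 d).
    * by rewrite z1 // z2 // addr0.
    * rewrite addrfctE e1 e2 -big_split; apply: eq_bigr => d _.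
      by rewrite mulrnDl.
  + exists (fun d => r *: a d); split=> [d|d dm|t].
    * by have [_ _ CZ] := submodule_lcs L (d + k).-1; exact: CZ (f d).
    * by rewrite z // scaler0.
    * rewrite scalrfctE e scaler_sumr; apply: eq_bigr => d _.
      by rewrite scalerMnr.
- move=> _ [d [v [md hv ->]]]; exists (fun e => if e == d then v else 0).
  split=> [e|e em|t]; first by case: eqP => [->|].
    by case: eqP => // ed; move: em; rewrite ed ltnNge md.
  have [dp|pd] := ltnP d p.
    rewrite (bigD1 (Ordinal dp)) //= eqxx big1 ?addr0 // => e.
    by rewrite -val_eqE /= => /negPf ->; rewrite mul0rn.
  rewrite /monomial; have -> : v = 0.
    by apply: nilL; apply: filtration_anti hv; exact: leq_trans (leq_addr _ _).
  by rewrite mul0rn big1 // => e _; case: eqP; rewrite mul0rn.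
Qed.

Lemma expnS_widen D d t : (d <= D)%N ->
  (\sum_(j < D.+1) 'C(d, j) * t ^ j)%N = (t.+1 ^ d)%N.
Proof.
move=> dD; rewrite -[t.+1]add1n expnDn.
rewrite (big_ord_widen D.+1 (fun j => 'C(d, j) * (1 ^ (d - j) * t ^ j))%N) //.
rewrite [RHS]big_mkcond; apply: eq_bigr => j _; rewrite exp1n mul1n ltnS.
by case: leqP => // dj; rewrite bin_small.
Qed.

(** The coefficients of a polynomial map of degree less than [p] are
combinations of its values, with coefficients whose denominators are prime to
[p]: the difference of a map of degree [D] has degree [D - 1] and leading
coefficient [D] times as large. *)
Lemma coef_lsub (J : set L) (D : nat) (a : nat -> L) :
    local_subgroup J -> (D <= p)%N ->
    (forall t, J (\sum_(d < D) a d *+ t ^ d)) ->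
  forall d, (d < D)%N -> J (a d).
Proof.
move=> hJ; elim: D a => [//|D IH] a Dp ha.
have JD : J (a D).
  case: D IH Dp ha => [|D] IH Dp ha.
    by have := ha 0%N; rewrite big_ord1.
  pose b j := \sum_(d < D.+2) a d *+ 'C(d, j) - a j.
  have bE : b D = a D.+1 *+ D.+1.
    rewrite /b !big_ord_recr /= binn mulr1n big1 ?add0r; last first.
      by move=> i _; rewrite bin_small ?mulr0n ?mul0rn //.
    by rewrite binSn addrAC subrr add0r.
  have bS : b D.+1 = 0.
    rewrite /b big_ord_recr /= binn mulr1n big1 ?add0r ?subrr //.
    by move=> i _; rewrite bin_small // mulr0n.
  apply: (lsub_divn hJ (n := D.+1)); first by apply: unit_lt.
  rewrite -bE; apply: IH (ltnSn D); first exact: ltnW.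
  move=> t; have -> : \sum_(d < D.+1) b d *+ t ^ d =
      \sum_(d < D.+2) a d *+ t.+1 ^ d - \sum_(d < D.+2) a d *+ t ^ d.
    transitivity (\sum_(d < D.+2) b d *+ t ^ d).
      by rewrite [RHS]big_ord_recr /= bS mul0rn addr0.
    under eq_bigr => j _ do rewrite mulrnBl -sumrMnl.
    rewrite sumrB exchange_big; congr (_ - _); apply: eq_bigr => d _.
    under eq_bigr => j _ do rewrite -mulrnA.
    by rewrite sumrMnr expnS_widen // -ltnS.
  by apply: (lsubB hJ); exact: ha.
move=> d; rewrite ltnS leq_eqVlt => /orP[/eqP-> //|].
apply: IH; first exact: ltnW.
move=> t; have := ha t; rewrite big_ord_recr /= => hs.
rewrite -[X in J X](addrK (a D *+ t ^ D)); apply: (lsubB hJ) => //.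
exact: lsubMn.
Qed.

End PolynomialMaps.

(** * Conjugation in the group of a nilpotent Lie algebra *)

Section ExpGroup.
Local Open Scope classical_set_scope.
Variables (p : nat) (R : comUnitRingType) (L : lieAlgType R).
Hypothesis p_gt1 : (1 < p)%N.
Hypothesis unit_lt : forall n, (0 < n < p)%N -> (n%:R : R) \is a GRing.unit.

Lemma bch_commute (M : lieAlgType R) (x y : M) :
  lie x y = 0 -> bch p x y = x + y.
Proof.
move=> xy0; apply/eqP; rewrite -subr_eq0; apply/eqP.
apply: (lsub_bch_lin unit_lt (local_set0 M)) => // w.
elim: w => [//|u [|v [|v' w]] IH] //= _ sw.
  have yx0 : lie y x = 0 by rewrite lieC xy0 oppr0.
  have := sw u (mem_head _ _); have := sw v; rewrite !inE eqxx orbT => /(_ isT).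
  by move=> /orP[] /eqP-> /orP[] /eqP->; rewrite ?liexx.
change (lie u (lie_word [:: v, v' & w]) = 0).
by rewrite (IH isT) ?lie0r // => t ht; apply: sw; rewrite inE ht orbT.
Qed.

Hypothesis nilL : lie_filtration p `<=` [set 0 : L].
Variables (G : finGroupType) (log : G -> L).
Hypothesis hlog : is_exp p log.

Lemma log_inj : injective log.
Proof. by case: hlog => /bij_inj. Qed.

Lemma log_surj v : exists x, log x = v.
Proof. by case: hlog => -[exp _ expK] _; exists (exp v). Qed.

Lemma logM x y : log (x * y)%g = bch p (log x) (log y).
Proof. by case: hlog. Qed.

Lemma log1 : log 1%g = 0.
Proof.
have := logM 1%g 1%g; rewrite mulg1 bch_commute ?liexx //.
by rewrite -{1}[log 1%g]addr0 => /addrI.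
Qed.

Lemma logX x n : log (x ^+ n)%g = log x *+ n.
Proof.
elim: n => [|n IH]; first by rewrite expg0 mulr0n log1.
by rewrite expgS logM IH bch_commute ?mulrS // lieMnr liexx mul0rn.
Qed.

Lemma logV x : log x^-1%g = - log x.
Proof.
have [y hy] := log_surj (- log x).
suff -> : x^-1%g = y by [].
apply: (mulgI x); apply: log_inj; rewrite mulgV log1 logM hy bch_commute ?subrr //.
by rewrite lieNr liexx oppr0.
Qed.

Lemma log_conj y z : log (y ^ z)%g = bch p (bch p (- log z) (log y)) (log z).
Proof. by rewrite conjgE mulgA !logM logV. Qed.

Let local_poly k m := submodule_local (@submodule_poly_maps R L k m).

Lemma poly_opp k m (P : nat -> L) : poly_maps k m P -> poly_maps k m (- P).
Proof. exact: lsubN (local_poly k m) _. Qed.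

Lemma poly_lie0 k m (P Q : nat -> L) :
  poly_maps 0 0 P -> poly_maps k m Q -> poly_maps k m (lie P Q).
Proof. exact: poly_lie. Qed.

Lemma poly_const0 (x : L) : poly_maps 0 0 (fun=> x).
Proof. exact: (poly_maps_anti _ _ (poly_const x)). Qed.

Lemma poly_linear0 (x : L) : poly_maps 0 0 (fun t => x *+ t).
Proof. exact: (poly_maps_anti _ _ (poly_linear x)). Qed.

Lemma poly_bch (P Q : nat -> L) :
  poly_maps 0 0 P -> poly_maps 0 0 Q -> poly_maps 0 0 (bch p P Q).
Proof.
move=> hP hQ; apply: (lsub_bch unit_lt (local_poly 0 0)).
elim=> [//|S [|T w] IH] _ sw.
  by move: (sw S (mem_head _ _)); rewrite !inE => /orP[] /eqP->.
change (poly_maps 0 0 (lie S (lie_word (T :: w)))); apply: poly_lie0.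
  by move: (sw S (mem_head _ _)); rewrite !inE => /orP[] /eqP->.
by apply: IH => // U hU; apply: sw; rewrite inE hU orbT.
Qed.

(** Conjugation by [Z] respects congruences modulo [poly_maps k m], an ideal of
[poly_maps 0 0]. *)
Lemma poly_conj_congr k m (Z P Q : nat -> L) :
    poly_maps 0 0 Z -> poly_maps 0 0 P -> poly_maps 0 0 Q ->
    poly_maps k m (P - Q) ->
  poly_maps k m (bch p (bch p (- Z) P) Z - bch p (bch p (- Z) Q) Z).
Proof.
move=> hZ hP hQ hPQ; have hN := poly_opp hZ.
have J0 (S : nat -> L) : poly_maps k m (S - S).
  by rewrite subrr; exact: (lsub0 (local_poly k m)).
have inner := bch_congr unit_lt (local_poly k m) (@poly_lie0 0 0)
  (@poly_lie0 k m) hN hN hP hQ (J0 _) hPQ.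
exact: (bch_congr unit_lt (local_poly k m) (@poly_lie0 0 0) (@poly_lie0 k m)
  (poly_bch hN hP) (poly_bch hN hQ) hZ hZ inner (J0 _)).
Qed.

Lemma sum_delta (k : nat) (v : L) t : (k < p)%N ->
  \sum_(d < p) (if d == k :> nat then v else 0) *+ t ^ d = v *+ t ^ k.
Proof.
move=> kp; rewrite (bigD1 (Ordinal kp)) //= eqxx big1 ?addr0 // => e.
by rewrite -val_eqE /= => /negPf ->; rewrite mul0rn.
Qed.

(** Conjugation commutes with powers, so [log (x ^ z)] is homogeneous of degree
one in [log x] although it is given by a Lie polynomial; only the linear part of
this polynomial can then contribute, whence additivity. *)
Lemma log_conjD w x y z : log w = log x + log y ->
  log (w ^ z)%g = log (x ^ z)%g + log (y ^ z)%g.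
Proof.
move=> hw; pose Z : nat -> L := fun=> log z.
pose lin (v : L) : nat -> L := fun t => v *+ t.
pose conj P := bch p (bch p (- Z) P) Z.
have expand u v : poly_maps 0 2 (bch p (lin u) (lin v) - (lin u + lin v)).
  apply: (lsub_bch_lin unit_lt (local_poly 0 2)) => //.
  by apply: words_in_poly => //; exact: poly_linear.
have linD u v : lin u + lin v = lin (u + v).
  by apply/funext => t; rewrite /lin mulrnDl.
have conj_lin v : conj (lin (log v)) = lin (log (v ^ z)%g).
  apply/funext => t; rewrite /conj !bch_fctE /lin -[RHS]logX.
  by rewrite -conjXg log_conj logX.
have conj_bch : conj (bch p (lin (log x)) (lin (log y))) =
    bch p (lin (log (x ^ z)%g)) (lin (log (y ^ z)%g)).
  apply/funext => t; rewrite /conj !bch_fctE /lin -!logX -!conjXg -!logM.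
  by rewrite -conjMg log_conj.
have := poly_conj_congr (poly_const0 (log z)) (poly_bch (poly_linear0 (log x))
  (poly_linear0 (log y))) (poly_linear0 (log w)) (k := 0) (m := 2).
rewrite -/(lin (log w)) {1}hw -linD => /(_ (expand _ _)).
rewrite -/(conj _) -/(conj _) conj_bch conj_lin.
move=> h; have := lsubB (local_poly 0 2) h (expand (log (x ^ z)%g) (log (y ^ z)%g)).
rewrite opprB addrC addrA subrK linD.
set D := (X in lin X); set E := log (w ^ z)%g.
have -> : lin D - lin E = lin (D - E).
  by apply/funext => t; rewrite /lin mulrnBl.
move=> /(poly_maps_coef nilL)[a [_ a0 ha]].
(* The linear coefficient, in two expressions of the same polynomial map. *)
suff : (D - E) - a 1%N = 0 by rewrite a0 // subr0 => /subr0_eq/esym.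
pose e d := (if d == 1%N then D - E else 0) - a d.
change ([set 0] (e 1%N)).
apply: (coef_lsub unit_lt (local_set0 L) (leqnn p)) => // t /=.
under eq_bigr => d _ do rewrite mulrnBl.
by rewrite sumrB sum_delta // -ha /lin expn1 subrr.
Qed.

Lemma bch_conj0 (Z : nat -> L) : bch p (bch p (- Z) 0) Z = 0.
Proof.
rewrite (bch_commute (lie0r _)) addr0 bch_commute ?addNr //.
by rewrite lieNl liexx oppr0.
Qed.

(** Up to sign, the bracket of [log z] and [log y] is the linear coefficient of the
polynomial [log (y ^ (z ^+ t))] in [t]. It is computed from the quadratic term of
[log ((y ^+ t) ^ (z ^+ t))], which only involves the terms of degree at most two of
the Baker-Campbell-Hausdorff series. *)
Lemma conj_lie (K : set L) y z : local_subgroup K ->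
    (forall t, K (log (y ^ (z ^+ t))%g - log y)) ->
  K (lie (log z) (log y)).
Proof.
move=> hK hconj; set X := log z; set Y := log y.
have lie2 : lie_filtration 2 (lie X Y) by apply: (@filtration_lie _ _ 1 1).
(* For [p = 2] the algebra is abelian, and 2 need not be invertible. *)
have [p2|] := leqP p 2.
  suff -> : lie X Y = 0 by exact: (lsub0 hK).
  by apply: nilL; apply: filtration_anti lie2.
move=> p2; pose lin (v : L) : nat -> L := fun t => v *+ t.
have hlX : poly_maps 0 1 (lin X) := poly_linear X.
have hlY : poly_maps 0 1 (lin Y) := poly_linear Y.
pose C1 := bch p (bch p (- lin X) (fun=> Y)) (lin X).
have C1E t : C1 t = log (y ^ (z ^+ t))%g.
  by rewrite /C1 !bch_fctE log_conj logX.
(* Every term of [C1] has a factor [Y], so its weight exceeds its degree in [t], and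
   [C1 t *+ t] still has degree less than [p]. *)
have : poly_maps 1 0 C1.
  rewrite -[C1]subr0 -(bch_conj0 (lin X)).
  apply: poly_conj_congr; [exact: poly_linear0 | exact: poly_const0 | |].
    exact: (lsub0 (local_poly 0 0)).
  by rewrite subr0; exact: poly_const.
move=> /(poly_maps_coef nilL)[a [aF _ ha]].
have Ka : K (a 1%N).
  rewrite -[a 1%N]subr0.
  pose e d := a d - if d == 0%N then Y else 0.
  change (K (e 1%N)); apply: (coef_lsub unit_lt hK (leqnn p)) => // t /=.
  under eq_bigr => d _ do rewrite mulrnBl.
  by rewrite sumrB sum_delta ?(ltnW p_gt1) // -ha C1E expn0 mulr1n.
pose B := bch p (- lin X) (lin Y).
pose C2 := bch p B (lin X).
have C2E t : C2 t = C1 t *+ t.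
  by rewrite /C2 /B !bch_fctE C1E -logX -conjXg log_conj !logX.
have u2 : (2%:R : R) \is a GRing.unit by apply: unit_lt.
have lPP (P Q : nat -> L) k m k' m' n : poly_maps k m P -> poly_maps k' m' Q ->
  (n <= m + m')%N -> poly_maps 0 n (lie P Q).
  by move=> hP hQ mn; apply: (poly_maps_anti _ mn (poly_lie hP hQ)).
have hj1 : poly_maps 0 3 (B - (- lin X + lin Y + 2%:R^-1 *: lie (- lin X) (lin Y))).
  apply: (lsub_bch_quad unit_lt (local_poly 0 3)) => //.
  by apply: words_in_poly => //; apply: poly_opp.
set j1 := (X in poly_maps 0 3 X) in hj1.
have BE : B = - lin X + lin Y - 2%:R^-1 *: lie (lin X) (lin Y) + j1.
  by rewrite /j1 lieNl scalerN [RHS]addrC subrK.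
clearbody j1.
have hq : poly_maps 0 2 (2%:R^-1 *: lie (lin X) (lin Y)).
  by case: (submodule_poly_maps L 0 2) => _ _; apply; exact: lPP hlX hlY _.
have hB : poly_maps 0 1 B.
  rewrite BE; apply: (lsubD (local_poly 0 1)).
    apply: (lsubB (local_poly 0 1)); last exact: (poly_maps_anti _ _ hq).
    by apply: (lsubD (local_poly 0 1)) => //; exact: poly_opp.
  exact: (poly_maps_anti _ _ hj1).
have hC2 : poly_maps 0 3 (C2 - (lin Y - lie (lin X) (lin Y))).
  have hj2 : poly_maps 0 3 (C2 - (B + lin X + 2%:R^-1 *: lie B (lin X))).
    apply: (lsub_bch_quad unit_lt (local_poly 0 3)) => //.
    exact: words_in_poly.
  have hj3 : poly_maps 0 3 (lie (j1 - 2%:R^-1 *: lie (lin X) (lin Y)) (lin X)).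
    rewrite lieBl; apply: (lsubB (local_poly 0 3)).
      exact: (lPP _ _ 0 3 0 1).
    exact: (lPP _ _ 0 2 0 1).
  have hj4 : poly_maps 0 3 (2%:R^-1 *: lie (j1 - 2%:R^-1 *: lie (lin X) (lin Y)) (lin X)).
    by case: (submodule_poly_maps L 0 3) => _ _; exact.
  have half (v : nat -> L) : 2%:R^-1 *: v + 2%:R^-1 *: v = v.
    rewrite -scalerDl (_ : _ + _ = 1) ?scale1r //.
    by apply: (mulrI u2); rewrite mulrDr !mulrV // mulr1.
  have lieB : lie B (lin X) = lie (j1 - 2%:R^-1 *: lie (lin X) (lin Y)) (lin X)
      - lie (lin X) (lin Y).
    rewrite BE -addrA [_ + j1]addrC !lieDl (lieNl (lin X)) liexx oppr0 add0r.
    by rewrite (lieC (lin Y)) addrC.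
  have := lsubD (local_poly 0 3) (lsubD (local_poly 0 3) hj2 hj1) hj4.
  congr (poly_maps 0 3); rewrite lieB scalerBr.
  move: (2%:R^-1 *: lie (j1 - _) _) => j3.
  set q := 2%:R^-1 *: lie (lin X) (lin Y).
  rewrite BE -/q -[lie (lin X) (lin Y)]half -/q.
  rewrite !opprD !opprK !addrA.
  rewrite [LHS](ACl (1*3*4*8*(2*6)*(9*5)*(10*7)))%AC /= !subrr !addr0.
  by rewrite addrC.
have [b [_ b0 hb]] := poly_maps_coef nilL hC2.
(* The coefficients of [C1 t *+ t]; the top one vanishes by weight. *)
pose c d := if d is d'.+1 then a d' else 0.
have hc t : \sum_(d < p) c d *+ t ^ d = C2 t.
  have ap0 : a p.-1 = 0.
    by apply: nilL; have := aF p.-1; rewrite addn1 prednK // ltnW.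
  rewrite C2E ha -sumrMnl; transitivity (\sum_(d < p.+1) c d *+ t ^ d).
    rewrite big_ord_recr /=; case: (p) ap0 p_gt1 => //= n -> _.
    by rewrite mul0rn addr0.
  rewrite big_ord_recl /= mul0rn add0r; apply: eq_bigr => d _.
  by rewrite -mulrnA expnS mulnC.
(* The coefficient of degree two in both expressions of [C2]. *)
suff : c 2 - b 2%N - (- lie X Y) = 0.
  by rewrite b0 // subr0 => /subr0_eq; rewrite -[c 2]/(a 1%N) => a1;
    rewrite -[lie X Y]opprK -a1; exact: (lsubN hK).
pose e d := c d - b d - ((if d == 1%N then Y else 0) + (if d == 2 then - lie X Y else 0)).
have -> : c 2 - b 2%N - (- lie X Y) = e 2 by rewrite /e /= add0r.
change ([set 0] (e 2)).
apply: (coef_lsub unit_lt (local_set0 L) (leqnn p)) => // t /=.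
under eq_bigr => d _ do rewrite /e !mulrnBl mulrnDl.
rewrite !sumrB big_split /= !sum_delta // hc -hb.
rewrite !(fct_sumE, addrfctE, opprfctE) lie_fctE /lin lieMnl lieMnr -mulrnA.
by rewrite expn1 -mulnn mulNrn opprB addrCA subrr addr0 subrr.
Qed.

Lemma log_mem (J : set L) x y : local_subgroup J ->
    (forall u v, J u -> J v -> J (lie u v)) ->
  J (log x) -> J (log y) -> J (log (x * y)%g).
Proof.
move=> hJ JJ Jx Jy; rewrite logM; apply: (lsub_bch unit_lt hJ).
elim=> [//|u [|v w] IH] _ sw.
  by move: (sw u (mem_head _ _)); rewrite !inE => /orP[] /eqP->.
change (J (lie u (lie_word (v :: w)))); apply: JJ.
  by move: (sw u (mem_head _ _)); rewrite !inE => /orP[] /eqP->.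
by apply: IH => // t ht; apply: sw; rewrite inE ht orbT.
Qed.

Lemma logM_mod (A J : set L) x y : local_subgroup J ->
    (forall u v, A u -> A v -> A (lie u v)) ->
    (forall u v, A u -> A v -> J (lie u v)) ->
  A (log x) -> A (log y) -> J (log (x * y)%g - (log x + log y)).
Proof.
move=> hJ AA AJ Ax Ay; rewrite logM; apply: (lsub_bch_lin unit_lt hJ) => //.
have Aw w : (0 < size w)%N -> {subset w <= [:: log x; log y]} -> A (lie_word w).
  elim: w => [//|u [|v w] IH] _ sw.
    by move: (sw u (mem_head _ _)); rewrite !inE => /orP[] /eqP->.
  change (A (lie u (lie_word (v :: w)))); apply: AA.
    by move: (sw u (mem_head _ _)); rewrite !inE => /orP[] /eqP->.
  by apply: IH => // t ht; apply: sw; rewrite inE ht orbT.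
move=> [|u [|v w]] //= _ sw; apply: AJ.
  by move: (sw u (mem_head _ _)); rewrite !inE => /orP[] /eqP->.
by apply: (Aw (v :: w)) => // t ht; apply: sw; rewrite inE ht orbT.
Qed.

End ExpGroup.

(** * Sums of additive characters *)

Section CharacterSums.

Lemma zmod_closedN (V : zmodType) (K : {pred V}) x :
  zmod_closed K -> x \in K -> - x \in K.
Proof. by case=> K0 KB Kx; rewrite -sub0r; exact: KB. Qed.

Lemma zmod_closedD (V : zmodType) (K : {pred V}) x y :
  zmod_closed K -> x \in K -> y \in K -> x + y \in K.
Proof.
case=> K0 KB Kx Ky; rewrite -[y]opprK; apply: (KB) => //.
by rewrite -sub0r; exact: KB.
Qed.

Lemma zmod_closedMz (V : zmodType) (K : {pred V}) x (n : int) :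
  zmod_closed K -> x \in K -> x *~ n \in K.
Proof.
move=> hK Kx; have KN y : y \in K -> - y \in K.
  by case: hK => K0 KB; rewrite -sub0r; exact: KB.
have Kn m : x *+ m \in K.
  elim: m => [|m IH]; first by rewrite mulr0n; case: hK.
  by rewrite mulrS; apply: zmod_closedD.
by case: n => m; rewrite ?NegzE ?mulrNz; [exact: Kn | apply/KN/Kn].
Qed.

Lemma sum_char_on (V : finZmodType) (A : {set V}) (f : V -> algC) :
    zmod_closed A -> {in A &, {morph f : x y / x + y >-> x * y}} ->
  f 0 = 1 ->
  \sum_(x in A) f x = (if [forall x in A, f x == 1] then #|A| else 0%N)%:R.
Proof.
move=> hA fM f0; case: ifP => [/forall_inP f1|/negbT].
  rewrite -sum1_card natr_sum; apply: eq_bigr => x /f1 /eqP //.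
rewrite negb_forall_in => /exists_inP[a Aa fa].
have : \sum_(x in A) f x = f a * \sum_(x in A) f x.
  rewrite mulr_sumr [LHS](reindex_inj (addrI a)) /=.
  apply: eq_big => [x|x]; last first.
    move=> Aax; rewrite fM //; rewrite -[x](addKr a) addrC.
    by case: hA => _; apply.
  apply/idP/idP => h; last exact: (zmod_closedD hA Aa h).
  by rewrite -[x](addKr a) addrC; case: hA => _; apply.
move/eqP; rewrite -subr_eq0 -{1}[\sum_(x in A) f x]mul1r -mulrBl mulf_eq0.
by rewrite subr_eq0 eq_sym (negPf fa) => /eqP.
Qed.

(** Both sides are the sum of the pairing over [A] and [B]: summing first over one
factor leaves the elements of the other that are orthogonal to it. *)
Lemma card_pairing (V W : finZmodType) (A : {set V}) (B : {set W})
    (b : V -> W -> algC) :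
    zmod_closed A -> zmod_closed B ->
    {in A &, forall x x', {in B, forall y, b (x + x') y = b x y * b x' y}} ->
    {in A, forall x, {in B &, {morph b x : y y' / y + y' >-> y * y'}}} ->
    {in A, forall x, b x 0 = 1} -> {in B, forall y, b 0 y = 1} ->
  (#|A| * #|[set y in B | [forall x in A, b x y == 1%R]]|)%N =
  (#|B| * #|[set x in A | [forall y in B, b x y == 1%R]]|)%N.
Proof.
move=> hA hB bDl bDr b0r b0l; apply/eqP; rewrite -(eqr_nat algC) !natrM.
have -> : #|A|%:R * #|[set y in B | [forall x in A, b x y == 1]]|%:R =
    \sum_(y in B) \sum_(x in A) b x y.
  rewrite mulrC -sum1_card natr_sum mulr_suml big_mkcond [RHS]big_mkcond.
  apply: eq_bigr => y _; rewrite inE; case: (boolP (y \in B)) => //= By.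
  rewrite sum_char_on ?b0l //; last by move=> x x' Ax Ax'; exact: bDl.
  by case: ifP => _; rewrite ?mul1r.
rewrite exchange_big /=; apply/eqP.
rewrite [RHS]mulrC -sum1_card natr_sum mulr_suml big_mkcond [RHS]big_mkcond.
apply: eq_bigr => x _; rewrite inE; case: (boolP (x \in A)) => //= Ax.
rewrite sum_char_on ?b0r //; last exact: bDr.
by case: ifP => _; rewrite ?mul1r.
Qed.

End CharacterSums.

(** * The orbit method for a finite nilpotent Lie ring *)

Section OrbitMethod.
Variables (V : finZmodType) (br : V -> V -> V).
Hypothesis brDl : forall x y z, br (x + y) z = br x z + br y z.
Hypothesis brDr : forall x y z, br z (x + y) = br z x + br z y.
Hypothesis brxx : forall x, br x x = 0.
Hypothesis br_jacobi :
  forall x y z, br (br x y) z = br x (br y z) - br y (br x z).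
Variables (gam : nat -> {set V}) (N : nat).
Hypothesis gam_closed : forall n, zmod_closed (gam n).
Hypothesis gam0 : gam 0%N = [set: V]%SET.
Hypothesis gamN : gam N = [set 0].
Hypothesis br_gam : forall n x y, x \in gam n -> br x y \in gam n.+1.

Lemma brC x y : br x y = - br y x.
Proof.
apply/eqP; rewrite -addr_eq0; apply/eqP.
by have := brxx (x + y); rewrite !(brDl, brDr) !brxx add0r addr0 addrC.
Qed.

Lemma br0l x : br 0 x = 0.
Proof. by apply: (addIr (br 0 x)); rewrite -brDl !add0r. Qed.

Lemma br0r x : br x 0 = 0.
Proof. by rewrite brC br0l oppr0. Qed.

Lemma brNl x y : br (- x) y = - br x y.
Proof. by apply: (addrI (br x y)); rewrite -brDl !subrr br0l. Qed.

Lemma brNr x y : br x (- y) = - br x y.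
Proof. by rewrite brC brNl -brC. Qed.

Lemma brBl x y z : br (x - y) z = br x z - br y z.
Proof. by rewrite brDl brNl. Qed.


Definition br_ideal (I : {set V}) :=
  zmod_closed I /\ forall x y, x \in I -> br x y \in I.

(** Let [m] be such that [I] is contained in [gam m] but not in [gam m.+1]. Then
bracketing maps [I] into its intersection with [gam m.+1], so that every additive
subgroup between these two is an ideal. Together with any further element of
[I], a maximal proper one spans [I]. *)
Lemma maximal_subideal (I : {set V}) : br_ideal I -> I != [set 0] ->
  exists I' : {set V}, [/\ br_ideal I', I' \proper I
    & forall x y, x \in I -> x \notin I' -> y \in I ->
        exists n : int, y - x *~ n \in I'].
Proof.
move=> [cI idI] nI.
have [m [mI mI']] : exists m, I \subset gam m /\ ~~ (I \subset gam m.+1).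
  have : ~~ (I \subset gam N).
    apply: contra nI; rewrite gamN finset.subset1 => /orP[] // /eqP I0.
    by case: cI; rewrite I0 inE.
  elim: (N) => [|n IH] hn; first by rewrite gam0 finset.subsetT in hn.
  by case: (boolP (I \subset gam n)) => [h|/IH //]; exists n.
pose P (K : {set V}) := [&& `[< zmod_closed K >], I :&: gam m.+1 \subset K & K \proper I].
have P0 : P (I :&: gam m.+1).
  apply/and3P; split=> //; last first.
    by rewrite properE finset.subsetIl finset.subsetI subxx.
  apply/asboolP; case: cI => I0 IB; case: (gam_closed m.+1) => g0 gB.
  split; first by rewrite inE I0 g0.
  by move=> x y /finset.setIP[Ix gx] /finset.setIP[Iy gy]; rewrite inE IB ?gB.
case: (@arg_maxnP _ _ P (fun K : {set V} => #|K|) P0) => I' /and3P[/asboolP cI' subI' prI'] maxI'.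
exists I'; split=> //.
- split=> // x y Ix; apply: (fintype.subsetP subI').
  have I'I := fintype.subsetP (proper_sub prI') _ Ix.
  by rewrite inE idI //= br_gam // (fintype.subsetP mI).
move=> x y Ix nI'x Iy.
pose K := [set v in I | `[< exists n : int, v - x *~ n \in I' >]].
have I'K : I' \subset K.
  apply/fintype.subsetP => v I'v; rewrite inE (fintype.subsetP (proper_sub prI')) //=.
  by apply/asboolP; exists 0; rewrite mulr0z subr0.
have Kx : x \in K.
  rewrite inE Ix; apply/asboolP; exists 1.
  by rewrite mulr1z subrr; case: cI'.
have cK : zmod_closed K.
  case: (cI) => I0 IB; split.
    by rewrite inE I0; apply/asboolP; exists 0; rewrite mulr0z subrr; case: cI'.
  move=> u v; rewrite !inE => /andP[Iu /asboolP[n hn]] /andP[Iv /asboolP[n' hn']].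
  rewrite IB //=; apply/asboolP; exists (n - n').
  have -> : u - v - x *~ (n - n') = (u - x *~ n) - (v - x *~ n').
    by rewrite mulrzBr !opprB !addrA [LHS](ACl (1*4*3*2))%AC.
  by case: cI' => _; apply.
have : K = I.
  apply/eqP; rewrite finset.eqEsubset; apply/andP; split.
    by apply/fintype.subsetP => v; rewrite inE => /andP[].
  apply: contraNT nI'x => nIK.
  have /maxI' : P K.
    rewrite /P (fintype.subset_trans subI' I'K) properE nIK /= andbT.
    apply/andP; split; first exact/asboolP.
    by apply/fintype.subsetP => v; rewrite inE => /andP[].
  by move=> le; have /eqP -> : I' == K by rewrite finset.eqEcard I'K.
by move=> KI; move: Iy; rewrite -KI inE => /andP[_ /asboolP].
Qed.

Lemma brMzl x y (n : int) : br (x *~ n) y = br x y *~ n.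
Proof.
have Mn (z : V) m : br (z *+ m) y = br z y *+ m.
  by elim: m => [|m IH]; rewrite ?mulr0n ?br0l // !mulrS brDl IH.
by case: n => m; rewrite ?NegzE ?mulrNz ?brNl Mn.
Qed.

Lemma brMzr x y (n : int) : br x (y *~ n) = br x y *~ n.
Proof. by rewrite brC brMzl -mulNrz -brC. Qed.

Section PolarizationOfCharacter.
Variable psi : V -> algC.
Hypothesis psi0 : psi 0 = 1.
Hypothesis psiD : {morph psi : x y / x + y >-> x * y}.

Let K : {set V} := [set v | psi v == 1].

Lemma psi_kerP v : reflect (psi v = 1) (v \in K).
Proof. by rewrite inE; exact: eqP. Qed.

(** Vergne's construction: going up a chain of ideals with cyclic steps, the
radical [Rad] of the form on each ideal is added. If [Rad] is not contained in the
previous ideal [I'], then [I] is spanned by [I'] and an element of [Rad]. Otherwise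
nothing is added, and what has to be shown is that nothing new is orthogonal to
[h]. The last property makes the sum of [h] and [Rad] a subring. *)
Lemma polarization_ideal (I : {set V}) : br_ideal I -> exists h : {set V},
  [/\ zmod_closed h, {in h &, forall x y, br x y \in h}, h \subset I,
      {in I, forall x, (x \in h) = [forall y in h, br x y \in K]}
    & forall y, {in I, forall z, br y z \in K} ->
        {in h, forall x, br y x \in h}].
Proof.
have cK : zmod_closed K.
  split=> [|x y /psi_kerP px /psi_kerP py]; apply/psi_kerP => //.
  by have := psiD (x - y) y; rewrite subrK px py mulr1 => <-.
have KN x : x \in K -> - x \in K.
  by move=> Kx; rewrite -sub0r; case: cK => K0 KB; apply: KB.
have [n] := ubnP #|I|; elim: n I => // n IH I cardI idI.
have [cI brI] := idI.
have [->|nI] := eqVneq I [set 0].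
  exists [set 0]; split=> //.
  - by split=> [|x y]; rewrite !inE // => /eqP-> /eqP->; rewrite subrr.
  - by move=> x y; rewrite !inE => /eqP-> _; rewrite br0l.
  - move=> x; rewrite !inE => /eqP->; rewrite eqxx; apply/esym/forall_inP => y.
    by rewrite inE => /eqP->; rewrite br0l; case: cK.
  - by move=> y _ x; rewrite !inE => /eqP->; rewrite br0r.
have [I' [idI' prI' cyc]] := maximal_subideal idI nI.
have sI'I := fintype.subsetP (proper_sub prI').
have [h [ch brh shI' hperp hstab]] := IH I' (leq_trans (proper_card prI') cardI) idI'.
have shI'P := fintype.subsetP shI'.
have [cI' brI'] := idI'.
have hstab' y : {in I, forall z, br y z \in K} -> {in h, forall x, br y x \in h}.
  by move=> yI; apply: hstab => z /sI'I; exact: yI.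
pose Rad := [set x in I | [forall z in I, br x z \in K]].
have inRad x : reflect (x \in I /\ {in I, forall z, br x z \in K}) (x \in Rad).
  rewrite inE; apply: (iffP andP) => -[Ix hx]; split=> //; exact/forall_inP.
have cRad : zmod_closed Rad.
  split; first by apply/inRad; case: cI => I0 _; split=> // z _; rewrite br0l; case: cK.
  move=> x y /inRad[Ix hx] /inRad[Iy hy]; apply/inRad; split.
    by case: cI => _; apply.
  by move=> z Iz; rewrite brBl; case: cK => _; apply; [exact: hx | exact: hy].
have RadI'h x : x \in Rad -> x \in I' -> x \in h.
  move=> /inRad[_ hx] I'x; rewrite hperp //; apply/forall_inP => y hy.
  by apply/hx/sI'I/shI'P.
have [sRI'|/fintype.subsetPn[r Rr nI'r]] := boolP (Rad \subset I').
  exists h; split=> //; first exact: fintype.subset_trans shI' (proper_sub prI').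
  move=> x Ix; have [I'x|nI'x] := boolP (x \in I'); first exact: hperp.
  have -> : (x \in h) = false by apply: contraNF nI'x; exact: shI'P.
  apply/esym/negP => /forall_inP hx.
  pose P := [set v in I | [forall y in I', br v y \in K]].
  (* The orthogonal [P] of [I'] in [I] is larger than [Rad]. An element of the
     difference [v] would be in [Rad], whether it lies in [I'] or not. *)
  have cardE' : (#|I| * #|Rad|)%N = (#|I'| * #|P|)%N.
    have psi1l y : psi (br 0 y) = 1 by rewrite br0l.
    have psi1r y : psi (br y 0) = 1 by rewrite br0r.
    have := card_pairing (b := fun x y => psi (br x y)) cI cI'
      (fun x x' _ _ y _ => etrans (congr1 psi (brDl x x' y)) (psiD _ _))
      (fun x _ y y' _ _ => etrans (congr1 psi (brDr y y' x)) (psiD _ _))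
      (fun x _ => psi1r x) (fun x _ => psi1l x).
    congr (_ * _ = _ * _)%N; apply: eq_card => y.
      rewrite inE; apply/andP/inRad => [[I'y /forall_inP hy]|[Iy hy]].
        split=> [|z Iz]; first exact: sI'I.
        by rewrite brC; apply: KN; rewrite inE; apply: hy.
      split; first by apply: (fintype.subsetP sRI'); apply/inRad.
      apply/forall_inP => z Iz; apply/eqP/psi_kerP.
      by rewrite brC; apply: KN; exact: hy.
    rewrite !inE; congr (_ && _); apply: eq_forallb_in => z I'z.
    by rewrite inE.
  have [v Pv nRv] : exists2 v, v \in P & v \notin Rad.
    apply/fintype.subsetPn; apply/negP => /subset_leq_card PR.
    have R0 : (0 < #|Rad|)%N by apply/card_gt0P; exists 0; case: cRad.
    suff : (#|I'| * #|P| < #|I| * #|Rad|)%N by rewrite cardE' ltnn.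
    apply: (leq_ltn_trans (leq_mul (leqnn _) PR)).
    by rewrite ltn_pmul2r // proper_card.
  case/negP: nRv; have [Iv vI'] : v \in I /\ {in I', forall y, br v y \in K}.
    by move: Pv; rewrite inE => /andP[Iv /forall_inP].
  apply/inRad; split=> // z Iz.
  have [I'v|nI'v] := boolP (v \in I').
    have hv : v \in h.
      by rewrite hperp //; apply/forall_inP => y hy; apply/vI'/shI'P.
    have [m hm] := cyc x z Ix nI'x Iz.
    rewrite -[z](subrK (x *~ m)) brDr; apply: (zmod_closedD cK); first exact: vI'.
    by rewrite brMzr; apply: (zmod_closedMz _ cK); rewrite brC; apply/KN/hx.
  have [m hm] := cyc v z Iv nI'v Iz.
  rewrite -[z](subrK (v *~ m)) brDr; apply: (zmod_closedD cK); first exact: vI'.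
  by rewrite brMzr brxx; apply: (zmod_closedMz _ cK); case: cK.
have /inRad[Ir hr] := Rr.
have hrN z : z \in I -> br z r \in K by move=> Iz; rewrite brC; apply/KN/hr.
(* The sum of [h] and of the multiples of [r], which contains [Rad]. *)
pose h' := [set x in I | `[< exists m : int, x - r *~ m \in h >]].
have inh' x : reflect (exists y (m : int), y \in h /\ x = y + r *~ m) (x \in h').
  rewrite inE; apply: (iffP andP) => [[Ix /asboolP[m hm]]|[y [m [hy ->]]]].
    by exists (x - r *~ m), m; rewrite subrK.
  split; last by apply/asboolP; exists m; rewrite addrK.
  by apply: (zmod_closedD cI); [apply/sI'I/shI'P | exact: zmod_closedMz].
have sh'I : h' \subset I by apply/fintype.subsetP => x; rewrite inE => /andP[].
have shh' x : x \in h -> x \in h'.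
  by move=> hx; apply/inh'; exists x, 0; rewrite mulr0z addr0.
have sRh' x : x \in Rad -> x \in h'.
  move=> Rx; have [Ix _] := inRad x Rx; have [m hm] := cyc r x Ir nI'r Ix.
  apply/inh'; exists (x - r *~ m), m; split; last by rewrite subrK.
  by apply: RadI'h => //; case: (cRad) => _; apply => //; exact: zmod_closedMz.
have h'c : zmod_closed h'.
  split; first by apply: shh'; case: ch.
  move=> _ _ /inh'[x [m [hx ->]]] /inh'[y [n' [hy ->]]]; apply/inh'.
  exists (x - y), (m - n'); split; first by case: ch => _; apply.
  by rewrite mulrzBr opprD addrACA.
exists h'; split=> //.
- move=> _ _ /inh'[x [m [hx ->]]] /inh'[y [n' [hy ->]]]; apply: shh'.
  rewrite brDl !brDr !brMzr !brMzl brxx !mul0rz addr0.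
  apply: (zmod_closedD ch); last exact/(zmod_closedMz _ ch)/(hstab' r hr).
  apply: (zmod_closedD ch); first exact: brh.
  apply: (zmod_closedMz _ ch); rewrite brC.
  by apply: (zmod_closedN ch); exact: (hstab' r hr).
- move=> x Ix; apply/idP/forall_inP.
    move=> /inh'[y [m [hy xE]]] _ /inh'[z [n' [hz ->]]].
    rewrite brDr; apply: (zmod_closedD cK).
      rewrite xE brDl; apply: (zmod_closedD cK).
        have := hperp y (shI'P y hy); rewrite hy => /esym/forall_inP; exact.
      by rewrite brMzl; apply: (zmod_closedMz _ cK); apply/hr/sI'I/shI'P.
    by rewrite brMzr; apply: (zmod_closedMz _ cK); exact: hrN.
  move=> hx; have [m hm] := cyc r x Ir nI'r Ix.
  apply/inh'; exists (x - r *~ m), m; split; last by rewrite subrK.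
  rewrite hperp //; apply/forall_inP => y hy; rewrite brBl.
  have Iy := sI'I _ (shI'P _ hy).
  case: (cK) => _; apply; first exact/hx/shh'.
  by rewrite brMzl; apply: (zmod_closedMz _ cK); exact: hr.
- move=> y hy _ /inh'[x [m [hx ->]]]; rewrite brDr.
  apply: (zmod_closedD h'c); first exact/shh'/hstab'.
  rewrite brMzr; apply: (zmod_closedMz _ h'c); apply: sRh'; apply/inRad.
  split; first by rewrite brC; apply/(zmod_closedN cI)/brI.
  move=> z Iz; rewrite br_jacobi; case: (cK) => _; apply.
    by apply: hy; exact: brI.
  by apply: hr; rewrite brC; apply/(zmod_closedN cI)/brI.
Qed.

End PolarizationOfCharacter.

Variables (G : finGroupType) (log : G -> V).
Hypothesis log_bij : bijective log.
Hypothesis log_one : log 1%g = 0.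
Hypothesis log_conj_add : forall w x y z, log w = log x + log y ->
  log (w ^ z)%g = log (x ^ z)%g + log (y ^ z)%g.
Hypothesis log_subgroup : forall h : {set V}, zmod_closed h ->
  {in h &, forall u v, br u v \in h} -> forall x y,
  log x \in h -> log y \in h -> log (x * y)%g \in h.

(** The condition on the absolute value makes the complex conjugate of [psi] its
inverse. *)
Definition is_add_char (psi : V -> algC) :=
  [/\ psi 0 = 1, {morph psi : x y / x + y >-> x * y} & forall v, `|psi v| = 1].

Hypothesis log_char : forall (h : {set V}) (psi : V -> algC),
  is_add_char psi -> zmod_closed h ->
  {in h &, forall u v, br u v \in h} ->
  {in h &, forall u v, psi (br u v) = 1} -> forall x y,
  log x \in h -> log y \in h -> psi (log (x * y)%g) = psi (log x) * psi (log y).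
Hypothesis log_stab : forall (psi : V -> algC) (z : G),
  is_add_char psi -> (forall x, psi (log (x ^ z)%g) = psi (log x)) ->
  forall y, psi (br (log z) (log y)) = 1.

Definition form_radical (psi : V -> algC) : {set V} :=
  [set x | [forall y, psi (br x y) == 1]].

Lemma polarization psi : is_add_char psi -> exists h : {set V},
  [/\ zmod_closed h, {in h &, forall x y, br x y \in h},
      {in h &, forall x y, psi (br x y) = 1}
    & (#|V| * #|form_radical psi| = #|h| * #|h|)%N].
Proof.
move=> [psi0 psiD _].
have [|h [ch brh _ hperp _]] := polarization_ideal psi0 psiD (I := [set: V]%SET).
  by split=> [|x y _]; [split=> [|x y _ _]|]; rewrite inE.
have hperpP x : reflect {in h, forall y, psi (br x y) = 1} (x \in h).
  rewrite hperp ?inE //; apply: (iffP forall_inP) => hx y hy.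
    by have := hx y hy; rewrite inE => /eqP.
  by rewrite inE; apply/eqP/hx.
exists h; split=> // [x y /hperpP hx|]; first exact: hx.
have cV : zmod_closed [set: V]%SET by split=> [|x y _ _]; rewrite inE.
have := card_pairing (b := fun x y => psi (br x y)) cV ch
  (fun x x' _ _ y _ => etrans (congr1 psi (brDl x x' y)) (psiD _ _))
  (fun x _ y y' _ _ => etrans (congr1 psi (brDr y y' x)) (psiD _ _))
  (fun x _ => etrans (congr1 psi (br0r x)) psi0)
  (fun x _ => etrans (congr1 psi (br0l x)) psi0).
rewrite cardsT; congr (_ * _ = _ * _)%N; apply: eq_card => y; rewrite !inE.
  apply/andP/forallP => [[hy /forall_inP yV] x|yV].
    have := yV x; rewrite inE => /(_ isT) /eqP yx; apply/eqP.
    have := psiD (br y x) (br x y).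
    by rewrite (brC y x) addNr psi0 yx mulr1 => /esym.
  split; first by apply/hperpP => x _; apply/eqP/yV.
  apply/forall_inP => x _; apply/eqP; have := psiD (br y x) (br x y).
  by rewrite (eqP (yV x)) mul1r (brC y x) addNr psi0 => /esym.
by apply/forall_inP/hperpP => hy z hz; apply/eqP/hy.
Qed.

Definition char_stab (psi : V -> algC) : {set G} :=
  [set z | [forall x, psi (log (x ^ z)%g) == psi (log x)]].


Lemma is_add_charV psi v : is_add_char psi -> (psi v)^* * psi v = 1.
Proof. by case=> _ _ /(_ v) nv; rewrite mulrC -normCK nv expr1n. Qed.

(** Conjugation being additive, [psi] composed with it is an additive character
again, and this is the orthogonality of two such characters. *)
Lemma conj_char_orthogonal psi z z' : is_add_char psi ->
  \sum_x psi (log (x ^ z)%g) * (psi (log (x ^ z')%g))^* =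
    (if (z'^-1 * z)%g \in char_stab psi then #|G| else 0%N)%:R.
Proof.
move=> hpsi; have [psi0 psiD psin] := hpsi; have [exp logK expK] := log_bij.
pose A z v := log (exp v ^ z)%g.
have AD y u v : A y (u + v) = A y u + A y v.
  by apply: log_conj_add; rewrite !expK.
have A0 y : A y 0 = 0 by apply: (addIr (A y 0)); rewrite -AD !add0r.
have -> : #|G| = #|[set: V]%SET|.
  by rewrite cardsT; apply: bij_eq_card log_bij.
have cV : zmod_closed [set: V]%SET by split=> [|x y _ _]; rewrite inE.
rewrite (reindex exp) /=; last by exists log => x _; [exact: expK | exact: logK].
transitivity (\sum_(v in [set: V]%SET) psi (A z v) * (psi (A z' v))^*).
  by apply: eq_bigl => v; rewrite inE.
rewrite (sum_char_on cV); last first.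
- by rewrite !A0 psi0 conjC1 mulr1.
- by move=> u v _ _; rewrite !AD !psiD rmorphM /= mulrACA.
congr ((if _ then _ else _)%:R); apply/forall_inP/idP => [hA|].
  rewrite inE; apply/forallP => x; apply/eqP.
  have := hA (log (x ^ z'^-1)%g); rewrite inE => /(_ isT) /eqP.
  rewrite /A logK -!conjgM mulVg conjg1 => h.
  have := is_add_charV (log x) hpsi; rewrite -[in X in X -> _](mul1r (psi _)) => h'.
  by rewrite -[LHS]mulr1 -(is_add_charV (log x) hpsi) mulrA h mul1r.
rewrite inE => /forallP hs v _; have := hs (exp v ^ z')%g.
rewrite -conjgM mulgA mulgV mul1g => /eqP h.
by rewrite /A h mulrC is_add_charV.
Qed.

Lemma char_stab_group psi : group_set (char_stab psi).
Proof.
apply/group_setP; split=> [|y z].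
  by rewrite inE; apply/forallP => x; rewrite conjg1.
rewrite !inE => /forallP hy /forallP hz; apply/forallP => x.
by rewrite conjgM (eqP (hz _)).
Qed.

Definition char_stab_Group psi := Group (char_stab_group psi).

Lemma sum_conj_char_square psi (H : {group G}) : is_add_char psi ->
  \sum_x (\sum_(z in H) psi (log (x ^ z)%g)) *
          (\sum_(z in H) psi (log (x ^ z)%g))^* =
  (#|G| * #|H| * #|char_stab psi :&: H|)%:R.
Proof.
move=> hpsi.
transitivity (\sum_(z' in H) \sum_(z in H) \sum_x
    psi (log (x ^ z)%g) * (psi (log (x ^ z')%g))^*).
  under eq_bigr => x _ do rewrite rmorph_sum mulr_sumr.
  rewrite exchange_big /=; apply: eq_bigr => z' _.
  under eq_bigr => x _ do rewrite mulr_suml.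
  by rewrite exchange_big.
transitivity (\sum_(z' in H) (#|G| * #|char_stab psi :&: H|)%:R : algC).
  apply: eq_bigr => z' Hz'.
  under eq_bigr => z Hz do rewrite (conj_char_orthogonal _ _ hpsi).
  rewrite -natr_sum (reindex_inj (mulgI z')) /=; congr (_%:R).
  rewrite (eq_bigl (fun z => z \in H)); last by move=> z; rewrite groupMl.
  under eq_bigr => z _ do rewrite mulKg.
  rewrite -big_mkcondr /= sum_nat_const mulnC; congr (_ * _)%N.
  by apply: eq_card => z; rewrite [RHS]finset.in_setI andbC.
by rewrite sumr_const -mulrnA mulnAC.
Qed.

Lemma card_char_stab psi : is_add_char psi ->
  (#|char_stab psi| <= #|form_radical psi|)%N.
Proof.
move=> hpsi; rewrite -(card_imset (mem (char_stab psi)) (bij_inj log_bij)).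
apply: subset_leq_card.
apply/fintype.subsetP => u /imsetP[z]; rewrite !inE => /forallP hz ->.
apply/forallP => v; have [exp logK expK] := log_bij.
rewrite -[v]expK; apply/eqP/log_stab => // x; exact/eqP/hz.
Qed.

(** The character is induced from the linear character [psi \o log] of the
subgroup that corresponds to a polarization; averaging [psi \o log] over
conjugates under this subgroup gives the same function extended by zero, because
the two functions agree on the subgroup and the average has no room left in mean
square elsewhere. The norm of the induced character is then at most 1 by the bound
on the stabilizer, hence equal to 1, and the bound is attained. *)
Lemma orbit_character psi : is_add_char psi ->
  exists (i : Iirr [set: G]%G) (n : nat),
  [/\ (n * n = #|V| * #|form_radical psi|)%N, (0 < n)%N,
      #|char_stab psi| = #|form_radical psi|
    & forall x, 'chi_i x = n%:R^-1 * \sum_z psi (log (x ^ z)%g)].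
Proof.
move=> hpsi; have [psi0 psiD psin] := hpsi.
have [h [ch brh psih cardh]] := polarization hpsi.
have HP : group_set [set x | log x \in h].
  apply/group_setP; split=> [|x y]; first by rewrite inE log_one; case: ch.
  by rewrite !inE; exact: log_subgroup.
pose H := Group HP.
have HE x : (x \in H) = (log x \in h) by rewrite inE.
have psiM : {in H &, forall x y,
    psi (log (x * y)%g) = psi (log x) * psi (log y)}.
  move=> x y; rewrite !HE; exact: (log_char hpsi ch brh psih).
have cardH : #|H| = #|h|.
  rewrite -(card_imset (mem H) (bij_inj log_bij)); apply: eq_card => v.
  apply/imsetP/idP => [[x Hx ->]|hv]; first by rewrite -HE.
  have [exp logK expK] := log_bij.
  by exists (exp v); rewrite ?HE expK.
have H0 : (0 < #|H|)%N by exact: cardG_gt0.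
have H0' : #|H|%:R != 0 :> algC by rewrite pnatr_eq0 -lt0n.
have psiJ : {in H &, forall x z, psi (log (x ^ z)%g) = psi (log x)}.
  move=> x z Hx Hz; rewrite conjgE !psiM ?groupM ?groupV //.
  by rewrite mulrCA -psiM ?groupV // mulVg log_one psi0 mulr1.
pose rho (x : G) : 'M[algC]_1 := (psi (log x))%:M.
have rhoP : mx_repr H rho.
  split=> [|x y Hx Hy]; first by rewrite /rho log_one psi0.
  by rewrite /rho psiM // scalar_mxM.
pose lam := cfRepr (MxRepresentation rhoP).
have lamE x : lam x = if x \in H then psi (log x) else 0.
  rewrite cfunE /= /rho mxtrace_scalar mulr1n.
  by case: (x \in H); rewrite ?mulr1n ?mulr0n.
pose avg x := #|H|%:R^-1 * \sum_(z in H) psi (log (x ^ z)%g).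
have avgH x : x \in H -> avg x = psi (log x).
  move=> Hx; rewrite /avg (eq_bigr (fun=> psi (log x))); last first.
    by move=> z Hz; rewrite psiJ.
  by rewrite sumr_const -[psi _ *+ _]mulr_natl mulKf.
have cardVG : #|V| = #|G| by rewrite (bij_eq_card log_bij).
have cardGR : (#|G| * #|form_radical psi| = #|H| * #|H|)%N.
  by rewrite -cardVG cardH.
have conjV n : (n%:R^-1 : algC)^* = n%:R^-1 by rewrite fmorphV rmorph_nat.
(* This is what the values on [H] alone already contribute. *)
have avg_sq : \sum_x avg x * (avg x)^* <= #|H|%:R.
  have -> : \sum_x avg x * (avg x)^* =
      #|H|%:R^-1 * #|H|%:R^-1 * (#|G| * #|H| * #|char_stab psi :&: H|)%:R.
    rewrite -(sum_conj_char_square H hpsi) mulr_sumr; apply: eq_bigr => x _.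
    by rewrite rmorphM /= conjV mulrACA.
  rewrite -invfM mulrC ler_pdivrMr ?mulr_gt0 ?ltr0n // -!natrM ler_nat.
  rewrite -cardGR [(#|G| * _)%N]mulnC -mulnA !leq_mul2l.
  rewrite (leq_trans _ (card_char_stab hpsi)) ?orbT //.
  exact/subset_leq_card/finset.subsetIl.
have lam_avg x : lam x = avg x.
  rewrite lamE; case: ifP => [/avgH //|/negbT nHx].
  have sq_ge0 y : 0 <= avg y * (avg y)^* by rewrite -normCK exprn_ge0.
  have : \sum_(y | y \notin H) avg y * (avg y)^* <= 0.
    move: avg_sq; rewrite (bigID (mem H)) /= (eq_bigr (fun=> 1)).
      by rewrite sumr_const gerDl.
    by move=> y Hy; rewrite avgH // mulrC is_add_charV.
  move=> le0; have /psumr_eq0P : \sum_(y | y \notin H) avg y * (avg y)^* = 0.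
    by apply/le_anti; rewrite le0 sumr_ge0.
  move=> /(_ (fun y _ => sq_ge0 y) x nHx)/eqP; rewrite mulf_eq0 conjC_eq0 orbb.
  by move=> /eqP.
pose chi := 'Ind[[set: G]%G] lam.
have chiE x : chi x = #|H|%:R^-1 * \sum_z psi (log (x ^ z)%g).
  rewrite cfIndE ?finset.subsetT //; congr (_ * _).
  under eq_bigr => y _ do rewrite lam_avg /avg.
  rewrite -mulr_sumr exchange_big /= (eq_bigr (fun=> \sum_z psi (log (x ^ z)%g))).
    by rewrite sumr_const -[X in _ * X]mulr_natl mulKf.
  move=> z Hz; rewrite [RHS](reindex_inj (mulIg z)).
  by apply: eq_big => [y|y _]; rewrite ?inE ?conjgM.
have chiC : chi \is a character by apply: cfInd_char; exact: cfRepr_char.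
have chi_norm : '[chi] = (#|H| * #|H|)%:R^-1 * (#|G| * #|char_stab psi|)%:R.
  rewrite cfdotE.
  have := sum_conj_char_square [set: G]%G hpsi; rewrite finset.setIT cardsT => hs.
  transitivity (#|G|%:R^-1 * \sum_x (#|H| * #|H|)%:R^-1 *
    ((\sum_(z in [set: G]%G) psi (log (x ^ z)%g)) *
      (\sum_(z in [set: G]%G) psi (log (x ^ z)%g))^*)).
    congr (_ * _); apply: eq_big => [x|x _]; first by rewrite inE.
    rewrite !chiE rmorphM /= conjV mulrACA natrM invfM; congr (_ * (_ * _^*)).
      by apply: eq_bigl => z; rewrite inE.
    by apply: eq_bigl => z; rewrite inE.
  rewrite -mulr_sumr hs mulrCA; congr (_ * _).
  by rewrite -mulnA natrM mulKf // pnatr_eq0 -lt0n -cardsT cardG_gt0.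
have HH0 : (#|H| * #|H|)%:R != 0 :> algC by rewrite natrM mulf_neq0.
have norm_le : '[chi] <= 1.
  rewrite chi_norm mulrC ler_pdivrMr ?ltr0n ?muln_gt0 ?H0 // mul1r ler_nat.
  by rewrite -cardGR leq_mul2l card_char_stab ?orbT.
have norm_gt0 : 0 < '[chi].
  rewrite chi_norm mulr_gt0 ?invr_gt0 ?ltr0n ?muln_gt0 ?H0 //.
  by rewrite (cardG_gt0 (char_stab_Group psi)) -cardsT cardG_gt0.
have norm1 : '[chi] = 1.
  have /natrP[m mE] := Cnat_cfdot_char chiC chiC.
  move: norm_le norm_gt0; rewrite mE -[1]/(1%:R) ler_nat ltr0n.
  by case: (m) => [|[|]].
have : chi \in irr [set: G]%G by rewrite irrEchar chiC norm1 eqxx.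
case/irrP => i chi_i; exists i, #|H|; split=> //; first by rewrite cardVG.
  apply/eqP; rewrite -(eqn_pmul2l (m := #|G|)); last by rewrite -cardsT cardG_gt0.
  rewrite cardGR -(eqr_nat algC); apply/eqP/(mulfI (invr_neq0 HH0)).
  by rewrite -chi_norm norm1 mulVf.
by move=> x; rewrite -chi_i chiE.
Qed.

Local Notation dual := (Iirr [set: V]%G).
Local Notation add_char j := ('chi[[set: V]%G]_j).

Lemma dual_linear (j : dual) : add_char j \is a linear_char.
Proof. exact/char_abelianP/FinRing.zmod_abelian. Qed.

Lemma dual_add_char (j : dual) : is_add_char (add_char j).
Proof.
have lin := dual_linear j; split.
- exact: lin_char1 lin.
- by move=> x y; apply: (lin_charM lin); rewrite inE.
- by move=> v; apply: (normC_lin_char lin); rewrite inE.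
Qed.

Lemma card_dual : #|{: dual}| = #|V|.
Proof.
rewrite card_ord NirrE -cardsT; apply/eqP.
by rewrite -card_classes_abelian FinRing.zmod_abelian.
Qed.

Lemma dual_orthogonal2 (u v : V) :
  \sum_(j : dual) add_char j u * (add_char j v)^* =
    (if u == v then #|V| else 0%N)%:R.
Proof.
have cuw (w w' : V) : (w * w')%g = (w' * w)%g.
  by rewrite !FinRing.zmodMgE addrC.
rewrite second_orthogonality_relation ?inE //.
have -> : 'C_[set: V]%G[u]%g = [set: V]%SET.
  by apply/finset.setIidPl/fintype.subsetP => w _; apply/cent1P; exact: cuw.
have -> : (u \in v ^: [set: V]%G)%g = (u == v).
  apply/imsetP/eqP => [[w _ ->]|->]; last by exists 1%g; rewrite ?inE ?conjg1.
  by rewrite conjgE cuw mulgK.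
by rewrite cardsT; case: eqP; rewrite ?mulr1n ?mulr0n.
Qed.

(** The coefficient of [add_char j] in ['chi_i], seen as a function on [V]. *)
Definition fourier (i : Iirr [set: G]%G) (j : dual) : algC :=
  #|G|%:R^-1 * \sum_x 'chi_i x * (add_char j (log x))^*.

Lemma card_log : #|V| = #|G|.
Proof. by rewrite (bij_eq_card log_bij). Qed.

Let G0 : #|G|%:R != 0 :> algC.
Proof. by rewrite pnatr_eq0 -lt0n -cardsT cardG_gt0. Qed.

Lemma fourier_inversion i x :
  'chi_i x = \sum_j fourier i j * add_char j (log x).
Proof.
rewrite /fourier.
under eq_bigr => j _ do rewrite -mulrA mulr_suml.
rewrite -mulr_sumr exchange_big /= (bigD1 x) //=.
under eq_bigr => j _ do rewrite -mulrA [(_)^* * _]mulrC.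
rewrite -mulr_sumr dual_orthogonal2 eqxx card_log big1 => [|y yx].
  by rewrite addr0 mulrCA mulVf ?mulr1.
under eq_bigr => j _ do rewrite -mulrA [(_)^* * _]mulrC.
rewrite -mulr_sumr dual_orthogonal2 (inj_eq (bij_inj log_bij)) eq_sym.
by rewrite (negPf yx) mulr0.
Qed.

Lemma fourier_parseval i : \sum_j fourier i j * (fourier i j)^* = 1.
Proof.
have := cfnorm_irr i; rewrite cfdotE => <-.
transitivity (\sum_j fourier i j * (#|[set: G]%G|%:R^-1 *
  \sum_x ('chi_i x)^* * add_char j (log x))).
  apply: eq_bigr => j _; congr (_ * _).
  rewrite /fourier rmorphM fmorphV /= rmorph_nat cardsT rmorph_sum.
  by congr (_ * _); apply: eq_bigr => x _; rewrite rmorphM /= conjCK.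
under eq_bigr => j _ do rewrite mulrCA mulr_sumr.
rewrite -mulr_sumr exchange_big; congr (_ * _).
apply: eq_big => [x|x _]; first by rewrite inE.
under eq_bigr => j _ do rewrite mulrCA.
by rewrite -mulr_sumr -fourier_inversion mulrC.
Qed.

Lemma orbit_irr : exists kappa : dual -> Iirr [set: G]%G, forall j,
  'chi_(kappa j) 1%g ^+ 2 * #|form_radical (add_char j)|%:R = #|V|%:R /\
  fourier (kappa j) j = ('chi_(kappa j) 1%g)^-1.
Proof.
suff /choice[kappa hkappa] : forall j : dual, exists i : Iirr [set: G]%G,
    'chi_i 1%g ^+ 2 * #|form_radical (add_char j)|%:R = #|V|%:R /\
    fourier i j = ('chi_i 1%g)^-1.
  by exists kappa.
move=> j; have hpsi := dual_add_char j.
have [i [m [mm m0 stabE chiE]]] := orbit_character hpsi.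
have m0' : m%:R != 0 :> algC by rewrite pnatr_eq0 -lt0n.
have chi1 : 'chi_i 1%g = m%:R^-1 * #|G|%:R.
  rewrite chiE (eq_bigr (fun=> 1)) => [|z _].
    by rewrite sumr_const cardT.
  by rewrite conj1g log_one; case: hpsi.
have RE : #|form_radical (add_char j)|%:R = m%:R * m%:R / #|G|%:R :> algC.
  by rewrite -natrM mm card_log natrM mulrC mulKf.
exists i; split.
  by rewrite chi1 card_log RE; field; rewrite G0 m0'.
rewrite chi1 /fourier.
under eq_bigr => x _ do rewrite chiE -mulrA mulr_suml.
rewrite -mulr_sumr exchange_big /=.
have orth z : \sum_x add_char j (log (x ^ z)%g) * (add_char j (log x))^* =
    (if z \in char_stab (add_char j) then #|G| else 0%N)%:R.
  have := conj_char_orthogonal z 1%g hpsi.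
  by rewrite invg1 mul1g => <-; apply: eq_bigr => x _; rewrite conjg1.
under eq_bigr => z _ do rewrite orth.
rewrite -natr_sum -big_mkcond sum_nat_const stabE natrM RE.
by field; rewrite G0 m0'.
Qed.

(** In each fibre of [kappa], Parseval leaves a nonnegative rest; the rests, weighted
by the squares of the degrees, add up to [|G| - |V| = 0]. *)
Lemma fourier_fibre (kappa : dual -> Iirr [set: G]%G) :
    (forall j, fourier (kappa j) j = ('chi_(kappa j) 1%g)^-1) ->
  forall i j, kappa j != i -> fourier i j = 0.
Proof.
move=> hk.
pose rest i : algC := \sum_(j | kappa j != i) fourier i j * (fourier i j)^*.
have sq_ge0 i j : 0 <= fourier i j * (fourier i j)^* by rewrite -normCK exprn_ge0.
have restE i : #|[pred j | kappa j == i]|%:R + 'chi_i 1%g ^+ 2 * rest i =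
    'chi_i 1%g ^+ 2.
  have chi0 := irr1_neq0 i.
  have := fourier_parseval i; rewrite (bigID (fun j => kappa j == i)) /= -/(rest i).
  rewrite (eq_bigr (fun=> ('chi_i 1%g ^+ 2)^-1)) => [|j /eqP <-]; last first.
    rewrite hk fmorphV /= geC0_conj ?char1_ge0 ?irr_char //.
      by rewrite expr2 invfM.
  rewrite (eq_bigl (fun j => j \in [pred j | kappa j == i])) // sumr_const => h.
  by rewrite -[RHS]mulr1 -[X in _ = _ * X]h mulrDr mulrnAr mulfV ?expf_neq0.
have : \sum_i 'chi_i 1%g ^+ 2 * rest i = 0.
  apply: (addrI (\sum_i #|[pred j | kappa j == i]|%:R)).
  rewrite -big_split /= (eq_bigr _ (fun i _ => restE i)) irr_sum_square addr0.
  rewrite cardsT -card_log -card_dual -sum1_card natr_sum (partition_big kappa xpredT) //=.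
  by apply: eq_bigr => i _; rewrite -natr_sum sum1_card.
have rest_ge0 i : 0 <= 'chi_i 1%g ^+ 2 * rest i.
  by rewrite mulr_ge0 ?sumr_ge0 // exprn_ge0 ?char1_ge0 ?irr_char.
move/psumr_eq0P => /(_ (fun i _ => rest_ge0 i)) rest0 i j kj.
have /eqP := rest0 i isT; rewrite mulf_eq0 expf_eq0 (negPf (irr1_neq0 i)) /= => /eqP.
move=> /psumr_eq0P => /(_ (fun j _ => sq_ge0 i j) j kj)/eqP.
by rewrite mulf_eq0 conjC_eq0 orbb => /eqP.
Qed.

Theorem sum_irr_degree (n : nat) (x : G) : (0 < n)%N ->
  \sum_(i : Iirr [set: G]%G | 'chi_i 1%g == n%:R) 'chi_i x =
  n%:R^-1 * \sum_(j : dual |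
     (n * n * #|form_radical (add_char j)| == #|V|)%N) add_char j (log x).
Proof.
move=> n0; have [kappa hk] := orbit_irr.
have four0 := fourier_fibre (fun j => (hk j).2).
have condE j : (n * n * #|form_radical (add_char j)| == #|V|)%N =
    ('chi_(kappa j) 1%g == n%:R).
  have [hV _] := hk j; rewrite -(eqr_nat algC) -hV natrM.
  have R0 : #|form_radical (add_char j)|%:R != 0 :> algC.
    apply: contraTneq isT => R0; move: hV; rewrite R0 mulr0 => /esym/eqP.
    by rewrite card_log (negPf G0).
  rewrite (inj_eq (mulIf R0)) natrM -expr2 eq_sym eqrXn2 //.
  by rewrite char1_ge0 ?irr_char.
rewrite (partition_big kappa (fun i => 'chi_i 1%g == n%:R)) /=; last first.
  by move=> j; rewrite condE.
rewrite mulr_sumr; apply: eq_bigr => i /eqP in1.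
rewrite fourier_inversion (bigID (fun j => kappa j == i)) /= [X in _ + X]big1.
  rewrite addr0 mulr_sumr; apply: eq_big => j.
    by rewrite condE; case: (eqVneq (kappa j) i) => [->|]; rewrite ?in1 ?eqxx ?andbF.
  by move=> /eqP kj; rewrite -kj (hk j).2 kj in1.
by move=> j /four0->; rewrite mul0r.
Qed.

End OrbitMethod.

(** * Additive characters in coordinates *)

Section AdditiveCharacterOfField.
Variables (F : finFieldType) (tau : F -> algC).
Hypothesis tau_char : is_add_char tau.
Hypothesis tau_neq1 : exists c, tau c != 1.

Let tau0 : tau 0 = 1. Proof. by case: tau_char. Qed.
Let tauD : {morph tau : x y / x + y >-> x * y}. Proof. by case: tau_char. Qed.

Lemma tau_nondegenerate (d : F) : (forall c, tau (c * d) = 1) -> d = 0.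
Proof.
move=> h; apply/eqP/negP => /negP d0; case: tau_neq1 => c /eqP; apply.
by rewrite -(mulfVK d0 c).
Qed.

Lemma sum_tau : \sum_c tau c = 0.
Proof.
have cF : zmod_closed [set: F]%SET by split=> [|x y _ _]; rewrite inE.
transitivity (\sum_(c in [set: F]%SET) tau c).
  by apply: eq_bigl => c; rewrite inE.
rewrite (sum_char_on cF (fun x y _ _ => tauD x y) tau0).
case: ifP => // /forall_inP h; case: tau_neq1 => c /negP[].
by apply: h; rewrite inE.
Qed.

Lemma sum_tau_unit (d : F) :
  \sum_(c | c != 0) tau (c * d) = if d == 0 then #|F|%:R - 1 else - 1.
Proof.
have -> : \sum_(c | c != 0) tau (c * d) = \sum_c tau (c * d) - 1.
  by rewrite [in RHS](bigD1 0) //= mul0r tau0 addrAC subrr add0r.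
case: eqP => [->|/eqP d0].
  by under eq_bigr => c _ do rewrite mulr0 tau0; rewrite sumr_const cardT.
by rewrite -(reindex_inj (mulIf d0) (P := xpredT) (F := tau)) sum_tau sub0r.
Qed.

Lemma row_dotZ b (c : F) (y z : 'rV[F]_b) : row_dot (c *: y) z = c * row_dot y z.
Proof.
by rewrite /row_dot mulr_sumr; apply: eq_bigr => l _; rewrite mxE mulrA.
Qed.

(** The sum does not change when [y] is replaced by a nonzero multiple, so that it
may be averaged over the multiples. *)
Lemma sum_tau_cone b (S : pred 'rV[F]_b) (z : 'rV[F]_b) :
    (forall c y, c != 0 -> S (c *: y) = S y) ->
  \sum_(y | S y) tau (row_dot y z) =
    #|[pred y | S y && (row_dot y z == 0)]|%:R
      - (#|F|%:R - 1)^-1 * #|[pred y | S y && (row_dot y z != 0)]|%:R.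
Proof.
move=> SZ; set T := \sum_(y | S y) _.
have q1 : #|F|%:R - 1 != 0 :> algC.
  rewrite subr_eq0 -[1]/(1%:R) eqr_nat -(cards1 (0 : F)) -cardsT.
  apply: contraTneq isT => hc; case: tau_neq1 => c.
  have : [set: F]%SET = [set 0].
    by apply/esym/eqP; rewrite finset.eqEcard finset.subsetT hc leqnn.
  by move=> /setP/(_ c); rewrite !inE => /esym/eqP->; rewrite tau0 eqxx.
have TE c : c != 0 -> T = \sum_(y | S y) tau (c * row_dot y z).
  move=> c0; rewrite /T (reindex_inj (scalerI c0)).
  apply: eq_big => [y|y _]; first exact: SZ.
  by rewrite row_dotZ.
have : \sum_(c : F | c != 0) T = (#|F|%:R - 1) * T.
  rewrite (eq_bigl (mem [set~ 0])) => [|c]; last by rewrite !inE.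
  rewrite sumr_const cardsC1 -[LHS]mulr_natl; congr (_ * _).
  by rewrite -subn1 natrB // -cardsT; apply/card_gt0P; exists 0; rewrite inE.
rewrite (eq_bigr _ TE) exchange_big /=.
rewrite (eq_bigr (fun y => if row_dot y z == 0 then #|F|%:R - 1 else - 1)); last first.
  by move=> y _; rewrite sum_tau_unit.
rewrite (bigID (fun y => row_dot y z == 0)) /=.
rewrite (eq_bigr (fun=> #|F|%:R - 1)) => [|y /andP[_ ->] //].
rewrite [X in _ + X](eq_bigr (fun=> - 1)) => [|y /andP[_ /negPf->] //].
rewrite (eq_bigl (mem [pred y | S y && (row_dot y z == 0)])) //.
rewrite [X in _ + X](eq_bigl (mem [pred y | S y && (row_dot y z != 0)])) //.
rewrite !sumr_const mulNrn => h.
apply: (mulfI q1); rewrite -h mulrBr mulrA mulfV // mul1r.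
by rewrite -[X in X - _]mulr_natr.
Qed.

End AdditiveCharacterOfField.

Lemma exists_add_char (F : finFieldType) :
  exists2 tau : F -> algC, is_add_char tau & exists c, tau c != 1.
Proof.
have /card_gt1P[j1 [j2 [_ _ j12]]] : (1 < #|{: Iirr [set: F]%G}|)%N.
  by rewrite card_dual; apply/card_gt1P; exists 0, 1; rewrite eq_sym oner_eq0.
have [j j0] : exists j : Iirr [set: F]%G, j != 0.
  have [j10|] := eqVneq j1 0; last by exists j1.
  by exists j2; rewrite -j10 eq_sym.
exists 'chi_j; first exact: dual_add_char.
apply: contrapT => h; move: j0; rewrite -irr_eq1 => /eqP; apply.
apply/cfunP => c; rewrite cfun1E inE; apply: contrapT => h'; apply: h.
by exists c; apply/eqP.
Qed.

Section CoordinatesOnDerived.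
Variables (V : finZmodType) (br : V -> V -> V).
Hypothesis brDl : forall x y z, br (x + y) z = br x z + br y z.
Hypothesis brDr : forall x y z, br z (x + y) = br z x + br z y.
Hypothesis brxx : forall x, br x x = 0.

Variables (F : finFieldType) (tau : F -> algC).
Hypothesis tau_char : is_add_char tau.
Hypothesis tau_neq1 : exists c, tau c != 1.

Variables (b : nat) (D : {set V}) (coord : V -> 'rV[F]_b).
Hypothesis D_closed : zmod_closed D.
Hypothesis br_D : forall x y, br x y \in D.
Hypothesis coordD : {in D &, {morph coord : x y / x + y}}.
Hypothesis coord_inj : {in D &, injective coord}.
Hypothesis coord_surj : forall w, exists2 v, v \in D & coord v = w.

Definition coord_char (y : 'rV[F]_b) (v : V) : algC := tau (row_dot y (coord v)).

Let tau0 : tau 0 = 1. Proof. by case: tau_char. Qed.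
Let tauD : {morph tau : x y / x + y >-> x * y}. Proof. by case: tau_char. Qed.

Lemma row_dotDr n (y z z' : 'rV[F]_n) :
  row_dot y (z + z') = row_dot y z + row_dot y z'.
Proof.
by rewrite -big_split; apply: eq_bigr => l _; rewrite mxE mulrDr.
Qed.

Lemma row_dot0r n (y : 'rV[F]_n) : row_dot y 0 = 0.
Proof. by rewrite /row_dot big1 // => l _; rewrite mxE mulr0. Qed.

Lemma coord0 : coord 0 = 0.
Proof.
have D0 : 0 \in D by case: D_closed.
by apply: (addIr (coord 0)); rewrite -coordD // !add0r.
Qed.

Lemma card_derived : #|D| = (#|F| ^ b)%N.
Proof.
rewrite -[b in RHS]mul1n -card_mx -(card_in_imset coord_inj) -cardsT.
apply: eq_card => w; rewrite inE; apply/imsetP.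
by have [v Dv <-] := coord_surj w; exists v.
Qed.

Lemma coord_charD y : {in D &, {morph coord_char y : u v / u + v >-> u * v}}.
Proof. by move=> u v Du Dv; rewrite /coord_char coordD // row_dotDr tauD. Qed.

Lemma coord_char0 y : coord_char y 0 = 1.
Proof. by rewrite /coord_char coord0 row_dot0r tau0. Qed.

Lemma coord_charV y v : (coord_char y v)^* * coord_char y v = 1.
Proof. exact: is_add_charV tau_char. Qed.

Lemma coord_char_inj y y' : {in D, coord_char y =1 coord_char y'} -> y = y'.
Proof.
move=> h; apply/rowP => l; apply/eqP; rewrite -subr_eq0; apply/eqP.
apply: (tau_nondegenerate tau_neq1) => c.
have [v Dv cv] := coord_surj (c *: delta_mx 0 l).
have dotE z : row_dot z (coord v) = c * z 0 l.
  rewrite cv /row_dot (bigD1 l) //= !mxE !eqxx mulr1 mulrC big1 ?addr0 // => m ml.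
  by rewrite !mxE eqxx (negPf ml) mulr0 mulr0.
have := h v Dv; rewrite /coord_char !dotE mulrBr => hc.
have := tauD (c * y 0 l - c * y' 0 l) (c * y' 0 l); rewrite subrK hc.
move=> /esym; rewrite -[X in _ = X]mul1r; apply: mulIf.
apply/eqP => t0; have := is_add_charV (c * y' 0 l) tau_char.
by rewrite t0 mulr0 => /esym/eqP; rewrite oner_eq0.
Qed.

Local Notation dual := (Iirr [set: V]%G).
Local Notation add_char j := ('chi[[set: V]%G]_j).

Definition restricts (j : dual) (y : 'rV[F]_b) :=
  [forall v in D, add_char j v == coord_char y v].

(** Both sides are the sum over [j] and over [v] in [D] of
[add_char j v * (coord_char y v)^*]: the sum over [v] detects the restriction to
[D], and the sum over [j] detects [v = 0]. *)
Lemma card_restricts y : (#|D| * #|[pred j | restricts j y]|)%N = #|V|.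
Proof.
apply/eqP; rewrite -(eqr_nat algC) natrM; apply/eqP.
transitivity (\sum_(j : dual) \sum_(v in D) add_char j v * (coord_char y v)^*).
  rewrite mulrC -(sum1_card [pred j | restricts j y]) natr_sum mulr_suml.
  rewrite big_mkcond; apply: eq_bigr => j _.
  have [psi0 psiD _] := dual_add_char j.
  rewrite (sum_char_on D_closed); last first.
  - by rewrite psi0 coord_char0 conjC1 mulr1.
  - by move=> u v Du Dv; rewrite psiD coord_charD // rmorphM /= mulrACA.
  have -> : [forall v in D, add_char j v * (coord_char y v)^* == 1] = restricts j y.
    apply: eq_forallb_in => v Dv; apply/eqP/eqP => [h|->].
      by rewrite -[LHS]mulr1 -(coord_charV y v) mulrA h mul1r.
    by rewrite mulrC coord_charV.
  by rewrite inE mul1r; case: ifP.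
rewrite exchange_big /= (bigD1 0) /=; last by case: D_closed.
rewrite [X in _ + X]big1 ?addr0 => [|v /andP[Dv v0]].
  under eq_bigr => j _ do rewrite coord_char0 conjC1.
  have := dual_orthogonal2 (0 : V) 0; rewrite eqxx => <-.
  apply: eq_bigr => j _; congr (_ * _).
  by have [-> _ _] := dual_add_char j; rewrite conjC1.
rewrite -mulr_suml; have := dual_orthogonal2 v 0; rewrite (negPf v0).
rewrite (eq_bigr (fun j => add_char j v)) => [->|j _]; first by rewrite mul0r.
by have [-> _ _] := dual_add_char j; rewrite conjC1 mulr1.
Qed.

(** Distinct [y] give distinct characters of [D], and the [#|F| ^ b = #|D|] values of
[y] have [#|V|] extensions altogether, which is the number of all [j]. *)
Lemma restricts_unique j : #|[pred y | restricts j y]| = 1%N.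
Proof.
have le1 i : (#|[pred y | restricts i y]| <= 1)%N.
  rewrite leqNgt; apply/negP => /card_gt1P[y [y' [ry ry' /eqP]]]; apply.
  apply: coord_char_inj => v Dv.
  have /forall_inP/(_ v Dv)/eqP <- : restricts i y by [].
  by have /forall_inP/(_ v Dv)/eqP <- : restricts i y' by [].
have D0 : (0 < #|D|)%N by apply/card_gt0P; exists 0; case: D_closed.
have : (\sum_(i : dual) #|[pred y | restricts i y]| = \sum_(i : dual) 1)%N.
  rewrite sum1_card card_dual.
  under eq_bigr => i _ do rewrite -sum1_card big_mkcond.
  rewrite exchange_big /=.
  apply/eqP; rewrite -(eqn_pmul2l D0) big_distrr /=.
  rewrite (eq_bigr (fun=> #|V|)) => [|y _].
    rewrite sum_nat_const card_mx mul1n -card_derived.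
    by [].
  by rewrite -(card_restricts y) -(sum1_card [pred j | restricts j y]) [in RHS]big_mkcond.

move=> /eqP; rewrite eqn_leq => /andP[_].
move=> h; apply/eqP; rewrite eqn_leq le1 /= leqNgt ltnS leqn0; apply/negP => j0.
move: h; rewrite (bigD1 j) //= [in X in (_ <= X)%N](bigD1 j) //= (eqP j0) add0n.
by rewrite add1n ltnNge leq_sum.
Qed.

Lemma form_radical_restricts j y : restricts j y ->
  form_radical br (add_char j) = form_radical br (coord_char y).
Proof.
move=> /forall_inP h; apply/setP => x; rewrite !inE.
by apply: eq_forallb => z; rewrite (eqP (h _ (br_D x z))).
Qed.

Lemma sum_dual_derived (P : pred nat) v : v \in D ->
  #|D|%:R * \sum_(j : dual | P #|form_radical br (add_char j)|) add_char j v =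
  #|V|%:R *
    \sum_(y : 'rV[F]_b | P #|form_radical br (coord_char y)|) coord_char y v.
Proof.
move=> Dv.
have -> : \sum_(j : dual | P #|form_radical br (add_char j)|) add_char j v =
    \sum_(j : dual) \sum_(y | restricts j y)
      (if P #|form_radical br (coord_char y)| then coord_char y v else 0).
  rewrite big_mkcond; apply: eq_bigr => j _.
  rewrite (eq_bigr (fun=> if P #|form_radical br (add_char j)| then add_char j v else 0)).
    rewrite (eq_bigl (mem [pred y | restricts j y])) // sumr_const.
    by rewrite restricts_unique mulr1n.
  move=> y hy; rewrite (form_radical_restricts hy).
  by move: hy => /forall_inP/(_ v Dv)/eqP->.
rewrite (exchange_big_dep xpredT) //= !mulr_sumr [in RHS]big_mkcond.
apply: eq_bigr => y _.
rewrite (eq_bigl (mem [pred j | restricts j y])) // sumr_const.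
case: ifP => _; last by rewrite mul0rn mulr0.
by rewrite -[coord_char y v *+ _]mulr_natl mulrA -natrM card_restricts.
Qed.

End CoordinatesOnDerived.

Section RadicalRank.
Variables (V : finZmodType) (br : V -> V -> V).
Hypothesis brDl : forall x y z, br (x + y) z = br x z + br y z.
Hypothesis brDr : forall x y z, br z (x + y) = br z x + br z y.
Hypothesis brxx : forall x, br x x = 0.

Variables (F : finFieldType) (tau : F -> algC).
Hypothesis tau_char : is_add_char tau.
Hypothesis tau_neq1 : exists c, tau c != 1.

Variables (b : nat) (D : {set V}) (coord : V -> 'rV[F]_b).
Hypothesis D_closed : zmod_closed D.
Hypothesis br_D : forall x y, br x y \in D.
Hypothesis coordD : {in D &, {morph coord : x y / x + y}}.

(** Double counting for the pairing of [V] with the row vectors [v] given by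
[br x (pi v)]: the orthogonal of [V] is the kernel of [B], and the orthogonal of the
row vectors is the radical. *)
Lemma card_radical_rank a (y : 'rV[F]_b) (B : 'M[F]_a) (pi : 'rV[F]_a -> V) :
    (forall u v, row_dot y (coord (br (pi u) (pi v))) = (u *m B *m v^T) 0 0) ->
    (forall u v x, br x (pi (u + v)) = br x (pi u) + br x (pi v)) ->
    (forall x, exists u, forall z, br x z = br (pi u) z) ->
  (#|V| * #|F| ^ (a - \rank B) =
   #|F| ^ a * #|form_radical br (coord_char tau coord y)|)%N.
Proof.
move=> piB piD pi_surj; have [tau0 tauD _] := tau_char.
have c0 := coord0 D_closed coordD; have b0l := br0l brDl.
have b0r := br0r brDl brDr brxx.
have piC u x : br (pi u) x = - br x (pi u) by exact: brC.
pose P (x : V) (v : 'rV[F]_a) := tau (row_dot y (coord (br x (pi v)))).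
have PDl x x' v : P (x + x') v = P x v * P x' v.
  by rewrite /P brDl coordD ?br_D // row_dotDr tauD.
have PDr x v v' : P x (v + v') = P x v * P x v'.
  by rewrite /P piD coordD ?br_D // row_dotDr tauD.
have P0r x : P x 0 = 1.
  have h : br x (pi 0) = 0.
    by apply: (addIr (br x (pi 0))); rewrite -piD !add0r.
  by rewrite /P h c0 row_dot0r.
have P0l v : P 0 v = 1 by rewrite /P b0l c0 row_dot0r.
have cV : zmod_closed [set: V]%SET by split=> [|? ? _ _]; rewrite inE.
have cW : zmod_closed [set: 'rV[F]_a]%SET by split=> [|? ? _ _]; rewrite inE.
have := card_pairing (b := P) cV cW (fun x x' _ _ v _ => PDl x x' v)
  (fun x _ v v' _ _ => PDr x v v') (fun x _ => P0r x) (fun v _ => P0l v).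
rewrite !cardsT card_mx mul1n; congr (_ * _ = _ * _)%N.
  rewrite -mxrank_tr -mxrank_ker -card_rowg; apply: eq_card => v.
  rewrite !inE /= sub_kermx.
  apply/forall_inP/eqP => [h|vB x _].
    apply: trmx_inj; rewrite trmx_mul trmxK trmx0; apply/colP => i.
    rewrite [RHS]mxE; apply: (tau_nondegenerate tau_neq1) => c.
    have := h (pi (c *: delta_mx 0 i)); rewrite inE => /(_ isT)/eqP.
    rewrite /P piB -mulmxA -scalemxAl mxE -rowE [row _ _ _ _]mxE.
    done.
  have [u hu] := pi_surj x; rewrite /P hu piB -mulmxA.
  have -> : B *m v^T = 0 by rewrite -[B]trmxK -trmx_mul vB trmx0.
  by rewrite mulmx0 mxE tau0.
apply: eq_card => x; rewrite !inE /=.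
apply/forall_inP/forallP => [h z|h v _]; last exact: h.
have [u hu] := pi_surj z; have := h u; rewrite inE => /(_ isT).
by rewrite /P /coord_char (brC brDl brDr brxx x z) hu -(brC brDl brDr brxx).
Qed.

End RadicalRank.

(** * Extension of scalars *)

Section TensorGenerated.
Variables (R S : comNzRingType) (phi : {rmorphism R -> S}).
Variables (M : lmodType R) (T : zmodType) (t : M -> S -> T).
Hypothesis ht : is_tensor_product phi t.

(** The uniqueness half of the universal property, applied to the projection
onto the quotient by [A]. *)
Lemma tensor_ind (A : T -> Prop) :
    A 0 -> (forall u v, A u -> A v -> A (u - v)) -> (forall x a, A (t x a)) ->
  forall u, A u.
Proof.
move=> A0 AB At u.
pose I0 : {pred T} := [pred v | `[< A v >]].
have I0P : zmod_closed I0.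
  split=> [|v w /asboolP Av /asboolP Aw]; first exact: (asboolT A0).
  exact: (asboolT (AB v w Av Aw)).
pose I : zmodClosed T := HB.pack I0 (GRing.isZmodClosed.Build T I0 I0P).
pose Q := Quotient.quot I.
have pi_eq0 v : ((\pi_Q v)%qT == 0 :> Q) = (v \in I).
  by rewrite -[v in RHS]subr0 Quotient.idealrBE (raddf0 (\pi_Q)%qT).
have [_ /(_ Q (fun _ _ => 0))[|h _ hU]] := ht.
  by split=> * /=; rewrite ?addr0.
have h1 : (\pi_Q : T -> Q)%qT =1 h.
  apply: hU => x a; apply/eqP; rewrite pi_eq0; exact: (asboolT (At x a)).
have h2 : (\0%R : T -> Q) =1 h by apply: hU.
have : (\pi_Q u)%qT == 0 :> Q by rewrite h1 -h2.
by rewrite pi_eq0 => /asboolP.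
Qed.

End TensorGenerated.

Section FiniteFree.
Local Open Scope classical_set_scope.
Variables (R S : idomainType) (phi : {rmorphism R -> S}).
Hypothesis phi_inj : injective phi.
Hypothesis R_dvr : is_dvr R.

(** A shortest system of generators is a basis: by dividing a relation by a
generator of the ideal of its coefficients, one of them becomes invertible. *)
Lemma finite_free :
    (exists (n : nat) (w : 'I_n -> S), forall x, exists c : 'I_n -> R,
        x = \sum_i phi (c i) * w i) ->
  exists (n : nat) (w : 'I_n -> S),
    (forall x, exists c : 'I_n -> R, x = \sum_i phi (c i) * w i) /\
    (forall c : 'I_n -> R, \sum_i phi (c i) * w i = 0 -> forall i, c i = 0).
Proof.
move=> gen.
pose P n := `[< exists w : 'I_n -> S, forall x, exists c : 'I_n -> R,
  x = \sum_i phi (c i) * w i >].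
have exP : exists n, P n by case: gen => n hn; exists n; apply/asboolP.
case: (ex_minnP exP) => n /asboolP[w hw] minn; exists n, w; split=> // c c0 i.
apply: contrapT => /eqP ci0.
have [princ [_ nuD nuM] _] := R_dvr.
pose I : set R := [set x | exists r : 'I_n -> R, x = \sum_j r j * c j].
have [|d Id] := princ I.
  split=> [|_ _ [r ->] [r' ->]|s _ [r ->]].
  - by exists (fun=> 0); rewrite big1 // => j _; rewrite mul0r.
  - exists (fun j => r j + r' j); rewrite -big_split.
    by apply: eq_bigr => j _; rewrite mulrDl.
  - exists (fun j => s * r j); rewrite mulr_sumr.
    by apply: eq_bigr => j _; rewrite mulrA.
have Ic j : I (c j).
  exists (fun m => (m == j)%:R); rewrite (bigD1 j) //= eqxx mul1r.
  by rewrite big1 ?addr0 // => m /negPf->; rewrite mul0r.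
have /choice[c' cE] : forall j, exists c'j, c j = d * c'j.
  by move=> j; have := Ic j; rewrite Id => -[c'j _ <-]; exists c'j.
have d0 : d != 0 by apply: contraNneq ci0 => d0; rewrite cE d0 mul0r.
have [r dE] : I d by rewrite Id; exists 1 => //; rewrite mulr1.
have sum1 : \sum_j r j * c' j = 1.
  apply: (mulfI d0); rewrite mulr1 {2}dE mulr_sumr; apply: eq_bigr => j _.
  by rewrite cE mulrCA.
have [m um] : exists m, c' m \is a GRing.unit.
  apply: contrapT => nu; have : nonunits (1 : R).
    rewrite -sum1; apply: (big_ind (@nonunits R)) => [||j _].
    - by case: R_dvr => _ [].
    - exact: nuD.
    - by apply: nuM; apply/negP => uj; apply: nu; exists j.
  by rewrite /nonunits /= unitr1.
have rel : \sum_j phi (c' j) * w j = 0.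
  apply: (mulfI (x := phi d)); first by rewrite -(rmorph0 phi) (inj_eq phi_inj).
  rewrite mulr0 -[RHS]c0 mulr_sumr; apply: eq_bigr => j _.
  by rewrite cE rmorphM mulrA.
case: n => [|n] in w hw minn c c0 i ci0 I Id Ic c' cE r dE sum1 m um rel *.
  by case: i ci0.
have : P n.
  apply/asboolP; exists (fun j => w (lift m j)) => x.
  have [s sE] := hw x.
  exists (fun j => s (lift m j) - s m * (c' m)^-1 * c' (lift m j)).
  have wm : w m = - phi (c' m)^-1 * \sum_(j < n) phi (c' (lift m j)) * w (lift m j).
    move: rel; rewrite (bigD1_ord m) //= => /eqP; rewrite addr_eq0 => /eqP h.
    rewrite mulNr -mulrN -h mulrA -rmorphM mulVr // rmorph1 mul1r.
    by [].
  rewrite {1}sE (bigD1_ord m) //= wm mulNr mulrN mulr_sumr mulr_sumr addrC -sumrB.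
  apply: eq_bigr => j _; rewrite rmorphB !rmorphM mulrBl.
  by rewrite !mulrA.
by move/minn; rewrite ltnn.
Qed.

End FiniteFree.

(** * Coordinates on the derived algebra *)

Section ResidueLift.
Local Open Scope classical_set_scope.
Variables (R : comUnitRingType) (k : fieldType) (rho : {rmorphism R -> k}).
Hypothesis hrho : is_residue_map rho.

Definition res_lift (c : k) : R := xget 0 [set r | rho r = c].

Lemma res_liftK c : rho (res_lift c) = c.
Proof.
rewrite /res_lift; case: xgetP => [r _ //|h].
by case: (hrho) => /(_ c)[r rc] _; case: (h r).
Qed.

Lemma nonunits_subP (r s : R) : nonunits (r - s) <-> rho r = rho s.
Proof.
case: hrho => _ <-; rewrite rmorphB; split=> [/eqP|->]; last by rewrite subrr.
by rewrite subr_eq0 => /eqP.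
Qed.

Lemma res_scaleE (M : lmodType R) (r : R) (v : M) :
  (forall m, nonunits m -> m *: v = 0) -> res_scale rho (rho r) v = r *: v.
Proof.
move=> mv; apply/eqP; rewrite -subr_eq0 -scalerBl; apply/eqP/mv.
by apply/nonunits_subP; exact: res_liftK.
Qed.

Lemma res_lincombE (M : lmodType R) n (v : 'I_n -> M) (c : 'I_n -> R) :
    (forall i m, nonunits m -> m *: v i = 0) ->
  res_lincomb rho v (\row_i rho (c i)) = \sum_i c i *: v i.
Proof.
by move=> mv; apply: eq_bigr => i _; rewrite mxE res_scaleE // => m; exact: mv.
Qed.

Lemma is_res_basis_free (M : lmodType R) (A : set M) n (v : 'I_n -> M) :
    is_res_basis rho A [set 0] v -> A 0 ->
    (forall i m, nonunits m -> m *: v i = 0) ->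
  forall c : 'I_n -> R, \sum_i c i *: v i = 0 -> forall i, rho (c i) = 0.
Proof.
move=> [_ hv] A0 mv c c0 i; have [d [_ dU]] := hv 0 A0.
have d1 : d = \row_i rho (c i).
  by apply: dU; rewrite /= res_lincombE // c0 subrr.
have d2 : d = \row_i rho 0.
  apply: dU; rewrite /= res_lincombE // big1 ?subrr // => j _.
  by rewrite scale0r.
by have := congr1 (fun u : 'rV_n => u 0 i) d1; rewrite d2 !mxE rmorph0.
Qed.

End ResidueLift.

Section ScalarExtension.
Local Open Scope classical_set_scope.
Variables (R S : comUnitRingType) (phi : {rmorphism R -> S}).
Variables (g : lieAlgType R) (gS : lieAlgType S) (t : g -> S -> gS).
Hypothesis ht : is_scalar_extension phi t.

Lemma tensorDl x y a : t (x + y) a = t x a + t y a.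
Proof. by case: ht => -[[h _ _] _] _ _. Qed.

Lemma tensorZl r x a : t (r *: x) a = t x (phi r * a).
Proof. by case: ht => -[[_ _ h] _] _ _. Qed.

Lemma tensorZr c x a : c *: t x a = t x (c * a).
Proof. by case: ht. Qed.

Lemma tensor_lie x y a c : lie (t x a) (t y c) = t (lie x y) (a * c).
Proof. by case: ht. Qed.

Lemma tensor0l a : t 0 a = 0.
Proof. by apply: (addIr (t 0 a)); rewrite -tensorDl !add0r. Qed.

Lemma tensor_suml (I : Type) (r : seq I) (P : pred I) (F : I -> g) a :
  t (\sum_(i <- r | P i) F i) a = \sum_(i <- r | P i) t (F i) a.
Proof. by apply: (big_morph (t^~ a)) => [x y|]; rewrite ?tensorDl ?tensor0l. Qed.

Lemma tensorE x a : t x a = a *: t x 1.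
Proof. by rewrite tensorZr mulr1. Qed.

Lemma tensorZl1 r x : t (r *: x) 1 = phi r *: t x 1.
Proof. by rewrite tensorZl tensorZr. Qed.

(** The image of [A (x) S] in [gS]. *)
Definition tensor_span (A : set g) : set gS :=
  smallest (@is_submodule S gS) [set u | exists x a, A x /\ u = t x a].

Lemma submodule_tensor_span A : is_submodule (tensor_span A).
Proof. exact: smallest_submodule. Qed.

Lemma mem_tensor_span (A : set g) x a : A x -> tensor_span A (t x a).
Proof. by move=> Ax; apply: sub_smallest_submodule; exists x, a. Qed.

Lemma tensor_spanT u : tensor_span setT u.
Proof.
have loc := submodule_local (submodule_tensor_span setT).
have [htp _ _] := ht.
apply: (tensor_ind htp (A := tensor_span setT)).
- exact: lsub0 loc.
- exact: lsubB loc.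
- by move=> x a; exact: mem_tensor_span.
Qed.

Lemma tensor_span_ind (A : set g) (J : set gS) :
    is_submodule J -> (forall x, A x -> J (t x 1)) ->
  tensor_span A `<=` J.
Proof.
move=> hJ AJ; apply: smallest_submodule_sub => // _ [x [a [Ax ->]]].
by rewrite tensorE; case: hJ => _ _; apply; exact: AJ.
Qed.

Lemma tensor_span_lie (A B C : set g) :
    (forall x y, A x -> B y -> C (lie x y)) ->
  forall u v, tensor_span A u -> tensor_span B v -> tensor_span C (lie u v).
Proof.
move=> AB u v hu hv; apply: (lie_smallest_sub _ _ hu hv).
  exact: submodule_tensor_span.
move=> _ _ [x [a [Ax ->]]] [y [c [By ->]]].
by rewrite tensor_lie; apply: mem_tensor_span; exact: AB.
Qed.

Lemma lie_lcs_tensor n : lie_lcs gS n `<=` tensor_span (lie_lcs g n).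
Proof.
elim: n => [|n IH] u; first by move=> _; exact: tensor_spanT.
apply: smallest_submodule_sub; first exact: submodule_tensor_span.
move=> _ [v /IH hv [w _ <-]].
apply: (tensor_span_lie (B := setT) _ hv (tensor_spanT w)).
by move=> x y hx _; exact: lcs_lie.
Qed.

Lemma lcs_tensor_trivial n : lie_lcs g n `<=` [set 0] ->
  lie_lcs gS n `<=` [set 0].
Proof.
move=> hn u /lie_lcs_tensor; apply: tensor_span_ind.
  split=> [//|x y /= -> ->|a x /= ->]; by rewrite ?addr0 ?scaler0.
by move=> x /hn ->; rewrite tensor0l.
Qed.

Lemma lie_derived_lie (M : lieAlgType S) (u v : M) : lie_derived M (lie u v).
Proof. by apply: sub_smallest_submodule; exists u => //; exists v. Qed.

Lemma lie_derived_tensor : lie_derived gS `<=` tensor_span (lie_derived g).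
Proof.
apply: smallest_submodule_sub; first exact: submodule_tensor_span.
move=> _ [u _ [v _ <-]].
apply: (tensor_span_lie (A := setT) (B := setT)); try exact: tensor_spanT.
by move=> x y _ _; apply: sub_smallest_submodule; exists x => //; exists y.
Qed.

Lemma tensor_derived x a : lie_derived g x -> lie_derived gS (t x a).
Proof.
have [D0 DD DZ] : is_submodule (lie_derived gS) by exact: smallest_submodule.
suff : lie_derived g `<=` [set x | forall a, lie_derived gS (t x a)].
  by move=> h /h.
apply: smallest_submodule_sub.
  split=> [c|y z hy hz c|r y hy c] /=.
  - by rewrite tensor0l.
  - by rewrite tensorDl; apply: DD; [exact: hy | exact: hz].
  - by rewrite tensorZl; exact: hy.
move=> _ [y _ [z _ <-]] c.
by rewrite -[c]mul1r -tensor_lie; exact: lie_derived_lie.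
Qed.

Hypothesis unram : smallest (@is_ideal S) (phi @` @nonunits R) = @nonunits S.

Lemma nonunits_derived :
    (forall (r : R) (x : g), nonunits r -> lie_derived g x -> r *: x = 0) ->
  forall (s : S) (u : gS), nonunits s -> lie_derived gS u -> s *: u = 0.
Proof.
move=> hder s u; rewrite -unram => hs hu; move: u hu.
suff: [set s : S | forall u : gS, lie_derived gS u -> s *: u = 0] s by [].
apply: hs; split.
  split=> [u _|s1 s2 h1 h2 u hu|s1 s2 h2 u hu] /=.
  - by rewrite scale0r.
  - by rewrite scalerDl h1 // h2 // addr0.
  - by rewrite -scalerA h2 // scaler0.
move=> _ [r hr <-] u /lie_derived_tensor.
apply: (tensor_span_ind (J := [set v | phi r *: v = 0])).
  split=> [|v w /= hv hw|c v /= hv]; first by rewrite /= scaler0.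
    by rewrite scalerDr hv hw addr0.
  by rewrite scalerA mulrC -scalerA hv scaler0.
by move=> x hx /=; rewrite -tensorZl1 hder // tensor0l.
Qed.

End ScalarExtension.

Section CommutatorCoordinates.
Local Open Scope classical_set_scope.
Variables (R S : idomainType) (phi : {rmorphism R -> S}).
Hypothesis R_dvr : is_dvr R.
Hypothesis unramified : is_finite_unramified phi.
Variables (k F : fieldType).
Variables (rho : {rmorphism R -> k}) (rhoS : {rmorphism S -> F}).
Hypothesis hrho : is_residue_map rho.
Hypothesis hrhoS : is_residue_map rhoS.
Variable iota : {rmorphism k -> F}.
Hypothesis hiota : forall r : R, iota (rho r) = rhoS (phi r).
Variables (g : lieAlgType R) (gS : lieAlgType S) (t : g -> S -> gS).
Hypothesis ht : is_scalar_extension phi t.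
Hypothesis hder : forall (r : R) (x : g), nonunits r -> lie_derived g x -> r *: x = 0.
Variables (a b : nat) (e : 'I_a -> g) (f : 'I_b -> g).
Hypothesis he : is_res_basis rho [set: g] (lie_center g) e.
Hypothesis hf : is_res_basis rho (lie_derived g) [set 0] f.

Let Fb (l : 'I_b) : gS := t (f l) 1.
Let E (i : 'I_a) : gS := t (e i) 1.

Let submodule_derived (T : comUnitRingType) (M : lieAlgType T) :
  is_submodule (lie_derived M).
Proof. exact: smallest_submodule. Qed.

Let derived_f l : lie_derived g (f l).
Proof. by case: hf. Qed.

Let killed_f l m : nonunits m -> m *: f l = 0.
Proof. by move=> hm; exact: hder. Qed.

Lemma unramified_nonunits :
  smallest (@is_ideal S) (phi @` @nonunits R) = @nonunits S.
Proof. by case: unramified. Qed.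

Lemma nonunits_kill_derived (s : S) (u : gS) :
  nonunits s -> lie_derived gS u -> s *: u = 0.
Proof. exact: (nonunits_derived ht unramified_nonunits hder). Qed.

Lemma derived_basis l : lie_derived gS (Fb l).
Proof. exact: (tensor_derived ht). Qed.

Let killed_Fb l m : nonunits m -> m *: Fb l = 0.
Proof. by move=> hm; apply: nonunits_kill_derived => //; exact: derived_basis. Qed.

Lemma derived_lincomb (c : 'I_b -> S) : lie_derived gS (\sum_l c l *: Fb l).
Proof.
have [D0 DD DZ] := submodule_derived gS.
by apply: big_ind => [||l _]; [exact: D0 | exact: DD | apply: DZ; exact: derived_basis].
Qed.

Lemma derived_span (u : gS) : lie_derived gS u ->
  exists c : 'I_b -> S, u = \sum_l c l *: Fb l.
Proof.
move=> /(lie_derived_tensor ht).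
apply: (tensor_span_ind ht (J := [set u | exists c : 'I_b -> S, u = \sum_l c l *: Fb l])).
- split=> [|_ _ [c ->] [c' ->]|s _ [c ->]] /=.
  + by exists (fun=> 0); rewrite big1 // => l _; rewrite scale0r.
  + exists (fun l => c l + c' l); rewrite -big_split.
    by apply: eq_bigr => l _; rewrite scalerDl.
  + exists (fun l => s * c l); rewrite scaler_sumr.
    by apply: eq_bigr => l _; rewrite scalerA.
move=> x hx /=; have [_ /(_ x hx)[c [/= /subr0_eq xE _]]] := hf.
exists (fun l => phi (res_lift rho (c 0 l))).
rewrite xE (tensor_suml ht); apply: eq_bigr => l _.
by rewrite (tensorZl1 ht).
Qed.

(** As [S] is free over [R], the module [g (x) S] is a power of [g], where the
independence of the basis of the derived algebra is tested componentwise. *)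
Lemma derived_basis_free (c : 'I_b -> S) :
  \sum_l c l *: Fb l = 0 -> forall l, rhoS (c l) = 0.
Proof.
move=> c0 l; have [phi_inj fin _] := unramified.
have [n [w [wgen wfree]]] := finite_free phi_inj R_dvr fin.
have /choice[d dE] := wgen.
have dU (s : S) (d' : 'I_n -> R) : s = \sum_i phi (d' i) * w i -> d s = d'.
  move=> sE; apply/funext => i; apply/eqP; rewrite -subr_eq0; apply/eqP.
  apply: (wfree (fun i => d s i - d' i)).
  under eq_bigr => j _ do rewrite rmorphB mulrBl.
  by rewrite sumrB -dE -sE subrr.
pose F0 (x : g) (s : S) : 'I_n -> g := fun i => d s i *: x.
have [[bal univ] _ _] := ht.
have [|h hE _] := univ ('I_n -> g : zmodType) F0.
  split=> [x y s|x s s'|r x s]; apply/funext => i; rewrite /F0 /=.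
  - by rewrite scalerDr.
  - rewrite (dU (s + s') (fun i => d s i + d s' i)) ?scalerDl //.
    under eq_bigr => j _ do rewrite rmorphD mulrDl.
    by rewrite big_split -!dE.
  - rewrite (dU (phi r * s) (fun i => r * d s i)).
      by rewrite scalerA mulrC.
    under eq_bigr => j _ do rewrite rmorphM -mulrA.
    by rewrite -mulr_sumr -dE.
have hc i : \sum_m d (c m) i *: f m = 0.
  have : h (\sum_m c m *: Fb m) i = 0 by rewrite c0 raddf0.
  rewrite raddf_sum fct_sumE => hi; rewrite -[RHS]hi; apply: eq_bigr => m _.
  by rewrite /Fb (tensorZr ht) mulr1 hE.
have D0 : lie_derived g 0 by case: (submodule_derived g).
have cl i : rho (d (c l) i) = 0.
  exact: (is_res_basis_free hrho hf D0 killed_f (hc i) l).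
rewrite [c l]dE rmorph_sum big1 // => i _.
by rewrite rmorphM -hiota cl rmorph0 mul0r.
Qed.

Lemma res_coords_lincomb (c : 'I_b -> S) :
  res_coords rhoS Fb (\sum_l c l *: Fb l) = \row_l rhoS (c l).
Proof.
have hcs (d : 'rV[F]_b) : res_lincomb rhoS Fb d = \sum_l res_lift rhoS (d 0 l) *: Fb l.
  by [].
rewrite /res_coords; case: xgetP => [d _ /= |]; last first.
  move=> /(_ (\row_l rhoS (c l)))[] /=.
  by rewrite (res_lincombE hrhoS).
rewrite hcs => /eqP; rewrite -subr_eq0 -sumrB.
under eq_bigr => l _ do rewrite -scalerBl.
move=> /eqP/derived_basis_free h; apply/rowP => l; rewrite mxE.
have := h l; rewrite rmorphB (res_liftK hrhoS) => /eqP.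
by rewrite subr_eq0 => /eqP.
Qed.

Lemma res_coordsD (u v : gS) : lie_derived gS u -> lie_derived gS v ->
  res_coords rhoS Fb (u + v) = res_coords rhoS Fb u + res_coords rhoS Fb v.
Proof.
move=> /derived_span[c ->] /derived_span[c' ->].
rewrite -big_split /=; under eq_bigr => l _ do rewrite -scalerDl.
rewrite (res_coords_lincomb (fun l => c l + c' l)) !res_coords_lincomb.
by apply/rowP => l; rewrite !mxE rmorphD.
Qed.

Lemma res_coords_inj (u v : gS) : lie_derived gS u -> lie_derived gS v ->
  res_coords rhoS Fb u = res_coords rhoS Fb v -> u = v.
Proof.
move=> /derived_span[c ->] /derived_span[c' ->]; rewrite !res_coords_lincomb => cc.
apply: eq_bigr => l _; apply/eqP; rewrite -subr_eq0 -scalerBl; apply/eqP.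
apply: killed_Fb; apply/(nonunits_subP hrhoS).
by have := congr1 (fun u : 'rV_b => u 0 l) cc; rewrite !mxE.
Qed.

Lemma res_coords_surj (w : 'rV[F]_b) : exists2 u, lie_derived gS u &
  res_coords rhoS Fb u = w.
Proof.
exists (\sum_l res_lift rhoS (w 0 l) *: Fb l); first exact: derived_lincomb.
by rewrite res_coords_lincomb; apply/rowP => l; rewrite mxE (res_liftK hrhoS).
Qed.

(** A section of the projection of [gS] onto its quotient by the centre, in the
coordinates given by [e]; it is additive up to central elements only. *)
Definition quotient_lift (u : 'rV[F]_a) : gS := \sum_i res_lift rhoS (u 0 i) *: E i.

(** The maximal ideal kills the derived algebra, so it multiplies [gS] into the
centre. *)
Lemma lie_lincomb_res (c c' : 'I_a -> S) (z : gS) :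
    (forall i, rhoS (c i) = rhoS (c' i)) ->
  lie (\sum_i c i *: E i) z = lie (\sum_i c' i *: E i) z.
Proof.
move=> cc; apply/eqP; rewrite -subr_eq0 -lieBl -sumrB; apply/eqP.
have -> : \sum_i (c i *: E i - c' i *: E i) = \sum_i (c i - c' i) *: E i.
  by apply: eq_bigr => i _; rewrite scalerBl.
elim/big_rec: _ => [|i v _ IH]; first by rewrite lie0l.
rewrite lieDl IH addr0 lieZl; apply: nonunits_kill_derived.
  exact/(nonunits_subP hrhoS).
exact: lie_derived_lie.
Qed.

Lemma quotient_lift_surj (u : gS) :
  exists v, forall z, lie u z = lie (quotient_lift v) z.
Proof.
suff [c hc] : exists c : 'I_a -> S, forall z, lie u z = lie (\sum_i c i *: E i) z.
  exists (\row_i rhoS (c i)) => z; rewrite hc; apply: lie_lincomb_res => i.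
  by rewrite (res_liftK hrhoS) mxE.
have := tensor_spanT ht u.
apply: (tensor_span_ind ht (J := [set u | exists c : 'I_a -> S,
  forall z, lie u z = lie (\sum_i c i *: E i) z])).
- split=> [|v w [c hc] [c' hc']|s v [c hc]] /=.
  + exists (fun=> 0) => z; rewrite big1 // => l _; by rewrite scale0r.
  + exists (fun l => c l + c' l) => z; under eq_bigr => l _ do rewrite scalerDl.
    by rewrite big_split !lieDl hc hc'.
  + exists (fun l => s * c l) => z; under eq_bigr => l _ do rewrite -scalerA.
    by rewrite -scaler_sumr !lieZl hc.
move=> x _ /=; have [_ /(_ x I)[c [hc _]]] := he.
exists (fun i => phi (res_lift rho (c 0 i))) => z.
set s := \sum_i _ *: _.
have -> : s = t (res_lincomb rho e c) 1.
  rewrite /res_lincomb (tensor_suml ht); apply: eq_bigr => i _.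
  by rewrite (tensorZl1 ht).
rewrite -[x in LHS](subrK (res_lincomb rho e c)) (tensorDl ht) lieDl.
rewrite -[RHS]add0r; congr (_ + _).
have := tensor_spanT ht z.
apply: (tensor_span_ind ht (J :=
  [set z | lie (t (x - res_lincomb rho e c) 1) z = 0])).
- split=> [|v w /= hv hw|r v /= hv]; first by rewrite /= lie0r.
    by rewrite lieDr hv hw addr0.
  by rewrite lieZr hv scaler0.
by move=> y _ /=; rewrite (tensor_lie ht) hc (tensor0l ht).
Qed.

Lemma lie_quotient_liftD u v z :
  lie z (quotient_lift (u + v)) = lie z (quotient_lift u) + lie z (quotient_lift v).
Proof.
rewrite ![lie z _]lieC -opprD; congr (- _).
rewrite -lieDl -big_split /=.
under [in RHS]eq_bigr => i _ do rewrite -scalerDl.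
apply: lie_lincomb_res => i.
by rewrite rmorphD !(res_liftK hrhoS) mxE.
Qed.

Lemma res_coords_lie_lift u v l :
  res_coords rhoS Fb (lie (quotient_lift u) (quotient_lift v)) 0 l =
  \sum_i \sum_j u 0 i * v 0 j * iota (struct_const rho e f i j l).
Proof.
pose sc i j l := res_lift rho (struct_const rho e f i j l).
have lieE i j : lie (E i) (E j) = \sum_l phi (sc i j l) *: Fb l.
  rewrite /E (tensor_lie ht) mulr1.
  have Dij : lie_derived g (lie (e i) (e j)) by exact: lie_derived_lie.
  have -> : lie (e i) (e j) = \sum_l sc i j l *: f l.
    rewrite /sc /struct_const /res_coords; case: xgetP => [c _ /= {1}-> //|/= h].
    by have [_ /(_ _ Dij)[c [/= /subr0_eq cE _]]] := hf; case: (h c).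
  by rewrite (tensor_suml ht); apply: eq_bigr => m _; rewrite (tensorZl1 ht).
have -> : lie (quotient_lift u) (quotient_lift v) =
    \sum_l (\sum_i \sum_j res_lift rhoS (u 0 i) * res_lift rhoS (v 0 j)
      * phi (sc i j l)) *: Fb l.
  under [RHS]eq_bigr => m _ do rewrite scaler_suml.
  rewrite exchange_big /= /quotient_lift (big_morph (fun x => lie x _)
    (fun x y => lieDl x y _) (lie0l _)); apply: eq_bigr => i _.
  under [RHS]eq_bigr => m _ do rewrite scaler_suml.
  rewrite exchange_big /= (big_morph (lie _) (fun x y => lieDr x y _) (lie0r _)).
  apply: eq_bigr => j _; rewrite lieZl lieZr lieE !scaler_sumr.
  by apply: eq_bigr => m _; rewrite !scalerA.
rewrite res_coords_lincomb mxE rmorph_sum; apply: eq_bigr => i _.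
rewrite rmorph_sum; apply: eq_bigr => j _.
by rewrite !rmorphM -hiota !(res_liftK hrhoS) (res_liftK hrho).
Qed.

End CommutatorCoordinates.

(** * Sums of characters of a fixed degree *)

Section FiniteCopy.
Variables (T : zmodType) (G : finType) (exp : T -> G) (log : G -> T).

(** A copy of [T] on which the finiteness transferred from [G] can be declared. *)
Definition finite_copy (_ : cancel exp log) : Type := T.

Variable expK : cancel exp log.
HB.instance Definition _ := GRing.Zmodule.copy (finite_copy expK) T.
HB.instance Definition _ : isCountable (finite_copy expK) := CanIsCountable expK.
HB.instance Definition _ := fintype.isFinite.Build (finite_copy expK)
  (@pcan_enumP (finite_copy expK) G exp (Some \o log) (can_pcan expK)).
End FiniteCopy.

Section LazardOrbitMethod.
Local Open Scope classical_set_scope.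
Variables (p : nat) (R : comUnitRingType) (L : lieAlgType R).
Hypothesis p_gt1 : (1 < p)%N.
Hypothesis unit_lt : forall n, (0 < n < p)%N -> (n%:R : R) \is a GRing.unit.
Hypothesis nilL : lie_filtration p `<=` [set 0 : L].
Variables (G : finGroupType) (log : G -> L) (exp : L -> G).
Hypothesis hlog : is_exp p log.
Hypothesis expK : cancel exp log.

Let V : finZmodType := finite_copy expK.
Let br (u v : V) : V := lie (u : L) (v : L).

(** Multiplication by an integer invertible in [R] is injective on a finite subgroup,
hence bijective. *)
Lemma local_finite_subgroup (h : {set V}) : zmod_closed h ->
  local_subgroup [set v : L | (v : V) \in h].
Proof.
move=> hh; split=> [|x y hx hy|n x un hx] /=.
- by case: hh.
- by case: hh => _ /(_ x y hx hy).
have inj : injective (fun v : V => v *+ n).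
  move=> u v /(congr1 (fun w : L => (n%:R : R)^-1 *: w)).
  by rewrite -!scaler_nat !scalerA mulVr // !scale1r.
have sub : [set v *+ n | v in h]%SET \subset h.
  apply/fintype.subsetP => _ /imsetP[v hv ->].
  exact: (zmod_closedMz (n : int) hh hv).
have : [set v *+ n | v in h]%SET == h.
  by rewrite finset.eqEcard sub (card_imset _ inj) leqnn.
move=> /eqP hE; move: hx; rewrite -{1}hE => /imsetP[v hv ->].
by rewrite -scaler_nat scalerA mulVr // scale1r.
Qed.

Lemma char_kernel_local (psi : V -> algC) : is_add_char psi ->
  local_subgroup [set v : L | psi v = 1].
Proof.
move=> [psi0 psiD _].
pose K : {set V} := [set v : V | psi v == 1]%SET.
have KE (v : V) : (v \in K) = (psi v == 1) by rewrite inE.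
have cK : zmod_closed K.
  split=> [|x y]; rewrite !KE; first exact/eqP.
  move=> /eqP px /eqP py; have := psiD (x - y) y.
  by rewrite subrK px py mulr1 => <-.
have -> : [set v : L | psi v = 1] = [set v : L | (v : V) \in K].
  by apply/seteqP; split=> v /=; rewrite KE => /eqP.
exact: local_finite_subgroup.
Qed.

Lemma exp_sum_irr_degree (n : nat) (x : G) : (0 < n)%N ->
  \sum_(i : Iirr [set: G]%G | 'chi_i 1%g == n%:R) 'chi_i x =
  n%:R^-1 * \sum_(j : Iirr [set: V]%G |
     (n * n * #|form_radical br 'chi_j| == #|V|)%N) 'chi_j (log x : V).
Proof.
pose gam m : {set V} := [set v : V | `[< lie_lcs L m v >]]%SET.
have gamE m (v : V) : (v \in gam m) = `[< lie_lcs L m v >] by rewrite inE.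
apply: (@sum_irr_degree V br _ _ _ _ gam p.-1 _ _ _ _ G log).
- by move=> u v w; exact: lieDl.
- by move=> u v w; exact: lieDr.
- by move=> u; exact: liexx.
- by move=> u v w; exact: lie_jacobiE.
- move=> m; have loc := submodule_local (submodule_lcs L m).
  split=> [|u v]; rewrite !gamE; first exact: (asboolT (lsub0 loc)).
  by move=> /asboolP hu /asboolP hv; exact: (asboolT (lsubB loc hu hv)).
- by apply/setP => v; rewrite gamE inE; exact/asboolT.
- apply/setP => v; rewrite gamE inE; apply/asboolP/eqP => [/nilL //|->].
  exact: lsub0 (submodule_local (submodule_lcs L _)).
- by move=> m u v; rewrite !gamE => /asboolP hu; apply: asboolT; exact: lcs_lie.
- by case: hlog.
- exact: (log1 p_gt1 unit_lt hlog).
- by move=> w u v z; exact: (log_conjD p_gt1 unit_lt nilL hlog).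
- move=> h hh brh u v; apply: (log_mem unit_lt hlog (local_finite_subgroup hh)).
  by move=> u' v'; exact: brh.
- move=> h psi hpsi hh brh psih u v hu hv; have [psi0 psiD _] := hpsi.
  have : psi (log (u * v)%g - (log u + log v)) = 1.
    exact: (logM_mod p_gt1 unit_lt hlog (A := [set w : L | (w : V) \in h])
      (char_kernel_local hpsi) (fun u' v' hu' hv' => brh u' v' hu' hv')
      (fun u' v' hu' hv' => psih u' v' hu' hv') hu hv).
  move=> h1; have := psiD (log (u * v)%g - (log u + log v)) (log u + log v).
  by rewrite subrK h1 mul1r psiD.
- move=> psi z hpsi hz y.
  apply: (conj_lie p_gt1 unit_lt nilL hlog (char_kernel_local hpsi)) => m /=.
  have [psi0 psiD _] := hpsi.
  have hzm : psi (log (y ^ (z ^+ m))%g) = psi (log y).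
    elim: m => [|m IH]; first by rewrite expg0 conjg1.
    by rewrite expgSr conjgM hz IH.
  have ny := is_add_charV (log y : V) hpsi.
  have := psiD (log (y ^ (z ^+ m))%g - log y) (log y); rewrite subrK hzm => h.
  by rewrite -[LHS]mulr1 -ny [_^* * _]mulrC mulrA -h mulrC ny.
Qed.

End LazardOrbitMethod.

Section DerivedSubgroup.
Local Open Scope classical_set_scope.
Variables (p : nat) (R : comUnitRingType) (L : lieAlgType R).
Hypothesis p_gt1 : (1 < p)%N.
Hypothesis unit_lt : forall n, (0 < n < p)%N -> (n%:R : R) \is a GRing.unit.
Variables (G : finGroupType) (log : G -> L).
Hypothesis hlog : is_exp p log.

(** Modulo the derived algebra, [log] is a homomorphism to an abelian group. *)
Lemma log_der1 x : x \in [set: G]%G^`(1)%g -> lie_derived L (log x).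
Proof.
have loc : local_subgroup (lie_derived L).
  exact/submodule_local/smallest_submodule.
have logM_der y z : lie_derived L (log (y * z)%g - (log y + log z)).
  apply: (logM_mod p_gt1 unit_lt hlog (A := setT) loc) => // u v _ _.
  exact: lie_derived_lie.
have mulG y z : lie_derived L (log y) -> lie_derived L (log z) ->
    lie_derived L (log (y * z)%g).
  move=> hy hz; rewrite -[log (y * z)%g](subrK (log y + log z)).
  exact: (lsubD loc (logM_der y z) (lsubD loc hy hz)).
pose H := [set y | `[< lie_derived L (log y) >]]%SET.
have HE y : (y \in H) = `[< lie_derived L (log y) >] by rewrite inE.
have HP : group_set H.
  apply/group_setP; split=> [|y z]; rewrite !HE.
    by apply: asboolT; rewrite (log1 p_gt1 unit_lt hlog); exact: lsub0 loc.
  by move=> /asboolP hy /asboolP hz; apply: asboolT; exact: mulG.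
suff /fintype.subsetP sub : [set: G]%G^`(1)%g \subset Group HP.
  by move=> /sub; rewrite HE => /asboolP.
rewrite derg1 gen_subG; apply/fintype.subsetP => _ /imset2P[y z _ _ ->].
rewrite HE; apply: asboolT.
have -> : log [~ y, z]%g =
   (log [~ y, z]%g - (- log y + log (y ^ z)%g)) + (log (y ^ z)%g - log y).
  by rewrite [log (y ^ z)%g - _]addrC subrK.
apply: (lsubD loc).
  by rewrite -(logV p_gt1 unit_lt hlog) commgEl; exact: logM_der.
have -> : log (y ^ z)%g - log y =
   (log (z^-1 * (y * z))%g - (log z^-1%g + log (y * z)%g)) +
   (log (y * z)%g - (log y + log z)).
  rewrite -conjgE (logV p_gt1 unit_lt hlog) !opprD opprK !addrA.
  by rewrite [RHS](ACl (1*5*(2*6)*(3*4)))%AC /= subrr addNr !addr0.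
exact: (lsubD loc (logM_der _ _) (logM_der _ _)).
Qed.

End DerivedSubgroup.

Section ComplexPower.
Local Open Scope complex_scope.
Variable R : realType.

Lemma cpow_natX (q i : nat) (s : R[i]) : (0 < q)%N ->
  cpow q%:R (- (i%:R * (1 + s))) = (q ^ i)%:R^-1 * cpow (q ^ i)%:R (- s).
Proof.
move=> q0; have q0' : 0 < q%:R :> R by rewrite ltr0n.
have natC n : n%:R = (n%:R : R)%:C :> R[i] by rewrite rmorph_nat.
have lnq : ln (q ^ i)%:R = i%:R * ln q%:R :> R.
  by rewrite natrX lnXn // mulr_natl.
have expq : expR (- (i%:R * ln q%:R)) = (q ^ i)%:R^-1 :> R.
  by rewrite expRN -lnq lnK // posrE ltr0n expn_gt0 q0.
case: s => c d; rewrite /cpow lnq !natC -fmorphV /=.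
have mulC (u v w : R) : u%:C * (v +i* w) = (u * v) +i* (u * w).
  by apply/eqP; rewrite eq_complex /= !mul0r subr0 addr0 !eqxx.
rewrite mulC !mulrA -expq -expRD !mul0r subr0 addr0 !add0r.
have -> : - (i%:R * (1 + c)) * ln q%:R =
    - (i%:R * ln q%:R) + - c * (i%:R * ln q%:R) :> R by ring.
have -> : - (i%:R * d) * ln q%:R = - d * (i%:R * ln q%:R) :> R by ring.
by rewrite !mulrA.
Qed.

End ComplexPower.

Lemma comm_matrix_atE (R : comUnitRingType) (k : fieldType)
    (rho : {rmorphism R -> k}) (F : finFieldType) (iota : {rmorphism k -> F})
    (g : lieAlgType R) (a b : nat) (e : 'I_a -> g) (f : 'I_b -> g)
    (y : 'rV[F]_b) i j :
  comm_matrix_at iota (comm_matrix rho e f) y i j =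
  \sum_l iota (struct_const rho e f i j l) * y 0 l.
Proof.
rewrite /comm_matrix_at /comm_matrix !mxE raddf_sum; apply: eq_bigr => l _.
by rewrite /= mpoly.mmapZ mpoly.mmapX mpoly.mmap1U.
Qed.

Section ExtensionCharacters.
Variables (R S : idomainType) (phi : {rmorphism R -> S}).
Hypothesis R_dvr : is_dvr R.
Hypothesis unramified : is_finite_unramified phi.
Variables (k : fieldType) (F : finFieldType).
Variables (rho : {rmorphism R -> k}) (rhoS : {rmorphism S -> F}).
Hypothesis hrho : is_residue_map rho.
Hypothesis hrhoS : is_residue_map rhoS.
Variable iota : {rmorphism k -> F}.
Hypothesis hiota : forall r : R, iota (rho r) = rhoS (phi r).
Variables (g : lieAlgType R) (gS : lieAlgType S) (t : g -> S -> gS).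
Hypothesis ht : is_scalar_extension phi t.
Hypothesis hder : forall (r : R) (x : g), nonunits r -> lie_derived g x -> r *: x = 0.
Variables (a b : nat) (e : 'I_a -> g) (f : 'I_b -> g).
Hypothesis he : is_res_basis rho [set: g]%classic (lie_center g) e.
Hypothesis hf : is_res_basis rho (lie_derived g) [set 0]%classic f.

Variable p : nat.
Hypothesis p_gt1 : (1 < p)%N.
Hypothesis unit_lt : forall n, (0 < n < p)%N -> (n%:R : S) \is a GRing.unit.
Hypothesis nil_gS : (lie_filtration p `<=` [set 0 : gS])%classic.
Variables (G : finGroupType) (log : G -> gS) (exp : gS -> G).
Hypothesis hlog : is_exp p log.
Hypothesis expK : cancel exp log.

Let V : finZmodType := finite_copy expK.
Let br (u v : V) : V := lie (u : gS) (v : gS).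
Let coord (v : V) : 'rV[F]_b := res_coords rhoS (fun l => t (f l) 1) (v : gS).
Let D : {set V} := [set v : V | `[< lie_derived gS v >]]%SET.
Let B (y : 'rV[F]_b) : 'M[F]_a := comm_matrix_at iota (comm_matrix rho e f) y.
Let q := #|F|.

Let DE (v : V) : (v \in D) = `[< lie_derived gS v >].
Proof. by rewrite inE. Qed.

Let DP (v : V) : reflect (lie_derived gS v) (v \in D).
Proof. by rewrite DE; exact: asboolP. Qed.

Let loc : local_subgroup (lie_derived gS).
Proof. exact/submodule_local/smallest_submodule. Qed.

Let D_closed : zmod_closed D.
Proof.
split=> [|u v /DP hu /DP hv]; apply/DP; first exact: (lsub0 loc).
exact: (lsubB loc).
Qed.

Let br_D (u v : V) : br u v \in D.
Proof. by apply/DP; exact: lie_derived_lie. Qed.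

Let coordD : {in D &, {morph coord : u v / u + v}}.
Proof.
move=> u v /DP hu /DP hv.
exact: (res_coordsD R_dvr unramified hrho hrhoS hiota ht hder hf).
Qed.

Let coord_inj : {in D &, injective coord}.
Proof.
move=> u v /DP hu /DP hv.
exact: (res_coords_inj R_dvr unramified hrho hrhoS hiota ht hder hf).
Qed.

Let coord_surj w : exists2 v, v \in D & coord v = w.
Proof.
have [u hu uw] := res_coords_surj R_dvr unramified hrho hrhoS hiota ht hder hf w.
by exists (u : V) => //; apply/DP.
Qed.

Let brDl (x y z : V) : br (x + y) z = br x z + br y z.
Proof. exact: lieDl. Qed.
Let brDr (x y z : V) : br z (x + y) = br z x + br z y.
Proof. exact: lieDr. Qed.
Let brxx (x : V) : br x x = 0.
Proof. exact: liexx. Qed.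

Variable tau : F -> algC.
Hypothesis tau_char : is_add_char tau.
Hypothesis tau_neq1 : exists c, tau c != 1.

Let theta := coord_char tau coord.

Lemma q_gt1 : (1 < q)%N.
Proof. by apply/card_gt1P; exists 0, 1; rewrite eq_sym oner_eq0. Qed.

Lemma card_radical_theta y : #|V| = (q ^ \rank (B y) * #|form_radical br (theta y)|)%N.
Proof.
pose pi (u : 'rV[F]_a) : V := quotient_lift rhoS t e u.
have h : (#|V| * q ^ (a - \rank (B y)) =
    q ^ a * #|form_radical br (theta y)|)%N.
  apply: (card_radical_rank brDl brDr brxx tau_char tau_neq1 D_closed br_D coordD
    (pi := pi)).
  - move=> u v; rewrite /row_dot mxE.
    under [RHS]eq_bigr => j _ do rewrite mxE mulr_suml.
    rewrite [RHS]exchange_big /=.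
    transitivity (\sum_l \sum_i \sum_j
        y 0 l * (u 0 i * v 0 j * iota (struct_const rho e f i j l))).
      apply: eq_bigr => l _; rewrite /coord /br /pi.
      rewrite (res_coords_lie_lift R_dvr unramified hrho hrhoS hiota ht hder e hf).
      by rewrite mulr_sumr; apply: eq_bigr => i _; rewrite mulr_sumr.
    rewrite exchange_big; apply: eq_bigr => i _.
    rewrite exchange_big; apply: eq_bigr => j _.
    rewrite /B comm_matrix_atE mulr_sumr mulr_suml; apply: eq_bigr => l _.
    by rewrite mxE; ring.
  - by move=> u v x; exact: (lie_quotient_liftD unramified hrhoS ht hder).
  - move=> x.
    have [u hu] := quotient_lift_surj unramified hrhoS ht hder he (x : gS).
    by exists u.
have ra : (\rank (B y) <= a)%N by exact: rank_leq_row.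
apply/eqP; rewrite -(eqn_pmul2r (m := q ^ (a - \rank (B y)))).
  by rewrite h mulnAC -expnD subnKC.
by rewrite expn_gt0 (ltnW q_gt1).
Qed.

Lemma radical_theta_eq i y :
  (q ^ i * q ^ i * #|form_radical br (theta y)| == #|V|)%N = (\rank (B y) == 2 * i)%N.
Proof.
have V0 : (0 < #|V|)%N by apply/card_gt0P; exists 0.
have R0 : (0 < #|form_radical br (theta y)|)%N.
  by move: V0; rewrite (card_radical_theta y) muln_gt0 => /andP[].
rewrite (card_radical_theta y) eqn_pmul2r // -expnD eqn_exp2l ?q_gt1 //.
by rewrite addnn -mul2n eq_sym.
Qed.

(** A form with full radical comes from a character that is trivial on all brackets.
As [s *: lie u v = lie (s *: u) v], it is also trivial on the [S]-module that they
generate. *)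
Lemma radical_theta_full y : (#|form_radical br (theta y)| == #|V|) = (y == 0).
Proof.
have tau0 : tau 0 = 1 by case: tau_char.
have theta0 v : theta 0 v = 1.
  by rewrite /theta /coord_char /row_dot big1 ?tau0 // => l _; rewrite mxE mul0r.
apply/idP/eqP => [hV|->]; last first.
  rewrite -cardsT; apply/eqP; apply: eq_card => x; rewrite !inE.
  by apply/forallP => z; rewrite theta0.
have br1 u v : theta y (br u v) = 1.
  have : form_radical br (theta y) == [set: V]%SET.
    by rewrite finset.eqEcard finset.subsetT cardsT (eqP hV) leqnn.
  by move=> /eqP/setP/(_ u); rewrite !inE => /forallP/(_ v)/eqP.
apply: (coord_char_inj tau_char tau_neq1 coord_surj) => v /DP hv.
rewrite -/theta theta0.
have D0 : lie_derived gS 0 by exact: lsub0 loc.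
suff : (lie_derived gS `<=` [set w : gS |
    lie_derived gS w /\ forall s : S, theta y (s *: w : gS) = 1])%classic.
  by move=> /(_ v hv)[_ /(_ 1)]; rewrite scale1r.
have [_ _ DZ] : is_submodule (lie_derived gS) by exact: smallest_submodule.
apply: smallest_submodule_sub.
  split=> [|u w [hu tu] [hw tw]|s u [hu tu]].
  - split=> // s; rewrite scaler0.
    exact: (coord_char0 tau_char D_closed coordD).
  - split=> [|s]; first exact: (lsubD loc).
    rewrite scalerDr /theta (coord_charD tau_char coordD) //; last 2 first.
    + by apply/DP; exact: (DZ s u hu).
    + by apply/DP; exact: (DZ s w hw).
    by have := tu s; have := tw s; rewrite /theta => -> ->; rewrite mulr1.
  - by split=> [|s']; [exact: (DZ s u hu) | rewrite scalerA].
move=> _ [u _ [w _ <-]]; split=> [|s]; first exact: lie_derived_lie.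
by rewrite -lieZl; exact: br1.
Qed.

Lemma sum_irr_degree_derived (n : nat) (x : G) :
    (0 < n)%N -> lie_derived gS (log x) ->
  #|D|%:R * \sum_(i : Iirr [set: G]%G | 'chi_i 1%g == n%:R) 'chi_i x =
  n%:R^-1 * #|V|%:R *
    \sum_(y | (n * n * #|form_radical br (theta y)| == #|V|)%N)
      theta y (log x : V).
Proof.
move=> n0 hx; rewrite (exp_sum_irr_degree p_gt1 unit_lt nil_gS hlog expK) //.
rewrite mulrCA -mulrA; congr (_ * _).
apply: (sum_dual_derived tau_char tau_neq1 D_closed br_D coordD coord_inj
  coord_surj (fun m => n * n * m == #|V|)%N).
exact/DP.
Qed.

(** The case of degree one, evaluated at the identity: it counts the linear
characters, and only [y = 0] occurs. *)
Lemma card_derived_index : (#|D| * #|[set: G] : [set: G]^`(1)|%g)%N = #|V|.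
Proof.
have log10 := log1 p_gt1 unit_lt hlog.
apply/eqP; rewrite -(eqr_nat algC) natrM; apply/eqP.
have := sum_irr_degree_derived (n := 1) (x := 1%g) isT.
rewrite log10 => /(_ (lsub0 loc)).
rewrite [X in _ = _ * X -> _](eq_bigl (fun y => y == 0)); last first.
  by move=> y; rewrite !mul1n radical_theta_full.
rewrite big_pred1_eq invr1 mul1r.
have -> : theta 0 (0 : V) = 1.
  exact: (coord_char0 tau_char D_closed coordD).
rewrite mulr1 => <-; congr (_ * _).
rewrite -card_lin_irr -sum1_card natr_sum.
apply: eq_big => i; first by rewrite inE qualifE /= irr_char.
by rewrite inE qualifE /= => /andP[_ /eqP].
Qed.

(** All the characters have the same degree, so the complex power of the degree is a
common factor, left out here. *)
Theorem sum_irr_degree_points (i : nat) (x : G) : x \in [set: G]%G^`(1)%g ->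
  \sum_(j : Iirr [set: G]%G | 'chi_j 1%g == (q ^ i)%:R) 'chi_j x =
  #|[set: G] : [set: G]^`(1)|%g%:R * (q ^ i)%:R^-1 *
    ((K_count iota (comm_matrix rho e f) i (coord (log x)))%:R
     - (q%:R - 1)^-1 * (V_count iota (comm_matrix rho e f) i (coord (log x)))%:R).
Proof.
move=> /(log_der1 p_gt1 unit_lt hlog) hx.
have D0 : #|D|%:R != 0 :> algC.
  by rewrite pnatr_eq0 -lt0n; apply/card_gt0P; exists 0; case: D_closed.
apply: (mulfI D0).
rewrite sum_irr_degree_derived ?expn_gt0 ?(ltnW q_gt1) //.
rewrite !mulrA -natrM card_derived_index [_%:R^-1 * _]mulrC; congr (_ * _).
under eq_bigl => y do rewrite radical_theta_eq.
rewrite (sum_tau_cone tau_char tau_neq1 (S := fun y => \rank (B y) == 2 * i)%N) //.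
move=> c y c0; congr (_ == _).
have -> : B (c *: y) = c *: B y.
  apply/matrixP => i1 j1; rewrite [RHS]mxE /B !comm_matrix_atE mulr_sumr.
  by apply: eq_bigr => l _; rewrite mxE mulrCA.
exact: mxrank_scale_nz.
Qed.

End ExtensionCharacters.

Unset Implicit Arguments.
Set Strict Implicit.
Set Printing Implicit Defensive.

Theorem theorem2p1
  (p : nat) (hp : prime p)
  (o : idomainType) (ho : is_compact_dvr o) (hchar0 : [pchar o] =i pred0)
  (k : fieldType) (rho : {rmorphism o -> k}) (hrho : is_residue_map rho)
  (hchark : p \in [pchar k])
  (g : lieAlgType o) (hfin : finite_set [set: g]%classic)
  (c : nat) (hnil : has_nilpotency_class g c) (hcp : (c < p)%N)
  (hder : forall (r : o) (x : g), nonunits r -> lie_derived g x -> r *: x = 0)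
  (hcen : forall (r : o) (x : g), nonunits r -> lie_center g (r *: x))
  (a b : nat)
  (e : 'I_a -> g) (he : is_res_basis rho [set: g]%classic (lie_center g) e)
  (f : 'I_b -> g) (hf : is_res_basis rho (lie_derived g) [set 0]%classic f)
  (O : idomainType) (hO : is_dvr O)
  (phi : {rmorphism o -> O}) (hphi : is_finite_unramified phi)
  (Fq : finFieldType) (q : nat) (hq : #|Fq| = q)
  (rhoO : {rmorphism O -> Fq}) (hrhoO : is_residue_map rhoO)
  (iota : {rmorphism k -> Fq}) (hiota : forall r : o, iota (rho r) = rhoO (phi r))
  (gO : lieAlgType O) (t : g -> O -> gO) (ht : is_scalar_extension phi t)
  (G : finGroupType) (log : G -> gO) (hlog : is_exp p log)
  (R : realType) (sigma : {rmorphism algC -> R[i]})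
  (x : G) (hx : x \in [set: G]%G^`(1)%g) (i : nat) (s : R[i]) :
  let B := comm_matrix rho e f in
  let coords := res_coords rhoO (fun l => t (f l) 1) (log x) in
  zeta_deg sigma (q ^ i) s x =
    #|([set: G]%G / [set: G]%G^`(1))%g|%:R * cpow q%:R (- (i%:R * (1 + s))) *
    ((K_count iota B i coords)%:R
      - (q%:R - 1)^-1 * (V_count iota B i coords)%:R).
Proof.
have p_gt1 := prime_gt1 hp.
have o_dvr : is_dvr o by case: ho.
have hcharF : p \in [pchar Fq] by rewrite (fmorph_pchar iota).
have unit_lt n : (0 < n < p)%N -> (n%:R : O) \is a GRing.unit.
  move=> /andP[n0 np]; apply: contrapT => /negP nu.
  have /eqP : rhoO n%:R = 0 by case: hrhoO => _ h; apply/h.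
  by rewrite rmorph_nat -(dvdn_pcharf hcharF) gtnNdvd.
have nilO : (lie_filtration p `<=` [set 0 : gO])%classic.
  apply: (subset_trans (B := lie_lcs gO c)).
    by apply: lcs_anti; rewrite -ltnS (ltn_predK hcp).
  by apply: (lcs_tensor_trivial ht); case: hnil => -> _ y.
have [exp logK expK] := hlog.1.
have [tau tau_char tau_neq1] := exists_add_char Fq.
move=> B coords.
have q0 : (0 < q)%N by rewrite -hq; apply/card_gt0P; exists 0.
have := sum_irr_degree_points o_dvr hphi hrho hrhoO hiota ht hder he hf p_gt1
  unit_lt nilO hlog expK tau_char tau_neq1 i hx.
rewrite hq -/coords -/B => hsum.
rewrite /zeta_deg.
transitivity (sigma (\sum_(j : Iirr [set: G]%G | 'chi_j 1%g == (q ^ i)%:R)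
    'chi_j x) * cpow (q ^ i)%:R (- s)).
  rewrite rmorph_sum mulr_suml; apply: eq_bigr => j /eqP ->.
  by rewrite natrK.
rewrite hsum cpow_natX // !rmorphM fmorphV rmorphB rmorphM fmorphV rmorphB /=.
rewrite !rmorph_nat rmorph1 card_quotient ?der_norm //.
by rewrite -!mulrA; congr (_ * (_ * _)); rewrite mulrC.
Qed.
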